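(* Let $r\ge1$, let $x,x_1,\ldots,x_r$ be roots of unity, and let $p_1,\ldots,p_r,q$ be positive integers with $(p_j,x_j)\neq(1,1)$ for $j=1,\ldots,r$ and $(q,x)\neq(1,1)$. Then $$(x_1\cdots x_r)^{-1}\tilde S_{p_1,\ldots,p_r;q}\big(x_1,\ldots,x_r;x\big)+(-1)^{p_1+\cdots+p_r+q+r}\tilde S_{p_1,\ldots,p_r;q}\big(x_1^{-1},\ldots,x_r^{-1};x^{-1}\big)$$ reduces to a combination of cyclotomic Euler $\tilde S$-sums and cyclotomic Euler $R$-sums of lower orders (order $<r$).
   Context: For $p\in\mathbb{N}$, $n\ge 0$ and a root of unity $y$, put $\zeta_n(p;y)=\sum_{k=1}^n y^k/k^p$ and $t_n(p;y)=\sum_{k=1}^n y^k/(k-1/2)^p$ (empty sums are $0$). For $|y|\le1$, $(p,y)\neq(1,1)$: $\mathrm{Li}_p(y)=\sum_{n\ge1}y^n/n^p$ and $\mathrm{ti}_p(y)=\sum_{n\ge1}y^n/(n-1/2)^p$. For positive integers $p_1,\ldots,p_k,q$ and roots of unity $y_1,\ldots,y_k,y$ with $(q,y)\ne(1,1)$, the cyclotomic Euler $\tilde S$-sum is $\tilde S_{p_1,\ldots,p_k;q}(y_1,\ldots,y_k;y)=\sum_{n\ge1}\frac{t_n(p_1;y_1)\cdots t_n(p_k;y_k)}{n^q}y^n$ and the cyclotomic Euler $R$-sum is $R_{p_1,\ldots,p_k;q}(y_1,\ldots,y_k;y)=\sum_{n\ge0}\frac{\zeta_n(p_1;y_1)\cdots\zeta_n(p_k;y_k)}{(n+1/2)^q}y^n$;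 $k$ is the order. For $k=0$: $\tilde S_{\emptyset;q}(\emptyset;y)=\mathrm{Li}_q(y)$ and $R_{\emptyset;q}(\emptyset;y)=y^{-1}\mathrm{ti}_q(y)$. *)

(* Defs.v *)
From HB Require Import structures.
From mathcomp Require Import all_boot all_order all_algebra.
From mathcomp Require Import all_classical all_reals all_analysis.
From mathcomp Require Import complex.

Set Implicit Arguments.
Unset Strict Implicit.
Unset Printing Implicit Defensive.

Import Order.TTheory GRing.Theory Num.Theory numFieldNormedType.Exports.

Local Open Scope classical_set_scope.
Local Open Scope ring_scope.

Section CyclotomicEulerSums.
Variable R : realType.
Local Notation C := R[i].

Definition is_unity_root (z : C) : Prop :=
  exists2 n : nat, (0 < n)%N & n.-unity_root z.

(* The alias [C^o] carries the topology of the norm on [C]. *)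
Definition climn (u : nat -> C) : C := limn (u : nat -> C^o).

Definition zetan (n p : nat) (y : C) : C :=
  \sum_(1 <= k < n.+1) y ^+ k / k%:R ^+ p.

Definition tn (n p : nat) (y : C) : C :=
  \sum_(1 <= k < n.+1) y ^+ k / (k%:R - 2^-1) ^+ p.

(* For [k = 0] the products are empty, so [Ssum] is Li_q(y) and [Rsum] is
   y^{-1} ti_q(y). *)
Definition Ssum (k : nat) (p : 'I_k -> nat) (q : nat)
    (ys : 'I_k -> C) (y : C) : C :=
  climn (fun N => \sum_(1 <= n < N.+1)
    (\prod_(j < k) tn n (p j) (ys j)) / n%:R ^+ q * y ^+ n).

Definition Rsum (k : nat) (p : 'I_k -> nat) (q : nat)
    (ys : 'I_k -> C) (y : C) : C :=
  climn (fun N => \sum_(0 <= n < N.+1)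
    (\prod_(j < k) zetan n (p j) (ys j)) / (n%:R + 2^-1) ^+ q * y ^+ n).

Definition admissible (k : nat) (p : 'I_k -> nat) (q : nat)
    (ys : 'I_k -> C) (y : C) : Prop :=
  [/\ forall j, (0 < p j)%N, (0 < q)%N, forall j, is_unity_root (ys j),
      is_unity_root y & (q, y) <> (1%N, 1)].

Variant euler_sum (k : nat) : C -> Prop :=
| EulerS p q ys y of @admissible k p q ys y : euler_sum k (Ssum p q ys y)
| EulerR p q ys y of @admissible k p q ys y : euler_sum k (Rsum p q ys y).

(* The Q-subalgebra Q[G] of C generated by G. *)
Inductive Qalg (G : set C) : C -> Prop :=
| Qalg_rat (c : rat) : Qalg G (ratr c)
| Qalg_gen z of G z : Qalg G z
| Qalg_add z1 z2 of Qalg G z1 & Qalg G z2 : Qalg G (z1 + z2)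
| Qalg_mul z1 z2 of Qalg G z1 & Qalg G z2 : Qalg G (z1 * z2).

(* z is a combination of sums of order < r: linear in those sums, with
   coefficients polynomial in the order-zero sums (the values Li_q(y) and
   y^{-1} ti_q(y)) over the field Q(G).  When G consists of algebraic numbers,
   Q(G) = Q[G].  Products of two sums of positive order do not occur, and
   transcendental constants enter the coefficients only through order-zero
   sums; with arbitrary complex coefficients the notion would be void. *)
Definition lower_order_combination (G : set C) (r : nat) (z : C) : Prop :=
  exists (m : nat) (c s : 'I_m -> C),
    [/\ forall i, Qalg (G `|` euler_sum 0) (c i),
        forall i, exists2 k : nat, (k < r)%N & euler_sum k (s i)
      & z = \sum_(i < m) c i * s i].

End CyclotomicEulerSums.

(* Main.v *)
Require Import Defs.
From HB Require Import structures.
From mathcomp Require Import all_boot all_order all_algebra.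
From mathcomp Require Import all_classical all_reals all_analysis.
From mathcomp Require Import complex ring lra zify.

Import Order.TTheory GRing.Theory Num.Theory numFieldNormedType.Exports.

(** With [t_n] extended to negative [n] by its recurrence, the quantity of the
    theorem is, up to a factor, the bilateral sum over [n != 0] of
    [\prod_j t_n(p_j; x_j) * x^n / n^q].  Put [w = x * \prod_j x_j] and let
    [N, M] tend to infinity in the rational function of [s]
      [(\sum_(|n| <= N) w^n / (s - n)) * s^-q *
       \prod_j \sum_(m <= M) x_j^m / (s + m + 1/2)^(p_j)],
    whose residues add up to [0].  The residues at the integers [n != 0] give
    the bilateral sum with [t_n] replaced by [t_n - t_oo], hence the wanted
    quantity up to sums of lower order; the residue at [0] is a polynomial in
    order-zero sums; at [-(m + 1/2)] at least one of the [r] factors contributes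
    its polar part, so only products of at most [r - 1] sums [zeta_m] appear.
    The limit [N -> oo] is taken first; the limit [M -> oo] is exchanged with
    the conditionally convergent sums by Abel summation, with bounds that depend
    only on the square-summability of increments. *)

Set Implicit Arguments.
Unset Strict Implicit.
Unset Printing Implicit Defensive.

Local Open Scope classical_set_scope.
Local Open Scope ring_scope.

(** * Residues of products of simple fractions *)

(** Truncating the kernel and the r factors keeps everything a rational function, so the residue
    theorem becomes algebra with truncated Taylor polynomials and no contour has to be estimated.
    The twist w is forced by the half-integers: there the kernel contributes w^-m and the factors
    contribute (x_1...x_r)^m, and only x^-m may remain if the result is to be a series of R-sums.
    Symmetric truncation in n matters when w = 1: the two half-sums then diverge, while their
    symmetric combination converges. The analytic obstacle is the exponent 1. Both the outer series
    and the inner sums may converge only conditionally, so dominated convergence fails; the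
    increments of the inner sums, of size 1/n, are not summable but are square-summable. This weaker
    property survives products, translation and reversal, and by the Cauchy-Schwarz principle it
    still controls the error term of Abel summation. *)

Section Residues.
Variable F : fieldType.
Implicit Types (c d : F) (K : nat).

(* The Taylor polynomial of [1 / (d + 'X)] at [0]. *)
Definition geo K d : {poly F} := \poly_(e < K) ((-1) ^+ e * d ^- e.+1).

(* [loc K c d] is the expansion of [(s - c) / (s - d)] in [s - c]. *)
Definition loc K c d : {poly F} := if c == d then 1 else 'X * geo K (c - d).

Lemma geoP K d : d != 0 ->
  exists a, (d%:P + 'X) * geo K d = 1 + 'X^K * a%:P.
Proof.
move=> d0; exists (- (-1) ^+ K * d ^- K).
rewrite /geo poly_def; elim: K => [|K IH].
  by rewrite big_ord0 mulr0 expr0 invr1 expr0 mulr1 mul1r rmorphN rmorph1 subrr.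
rewrite big_ord_recr /= mulrDr IH -mul_polyC -addrA; congr (1 + _).
have -> : d ^- K = d * d ^- K.+1 by rewrite exprS invfM mulrA divff ?mul1r.
rewrite (exprS (-1)) (exprS 'X); set a := (-1) ^+ K; set b := d ^- K.+1.
by rewrite !(polyCM, polyCN, polyC1); ring.
Qed.

(** The partial fraction identity (d - d')/((s - d)(s - d')) = 1/(s - d) - 1/(s - d'), multiplied by
    (s - c)^2 and read modulo X^(K+1) with X = s - c. *)
Lemma locP K c d d' : d != d' -> exists V,
  (d - d')%:P * (loc K c d * loc K c d')
  = 'X * (loc K c d - loc K c d') + 'X^(K.+1) * V.
Proof.
move=> dd'; rewrite /loc; case: eqVneq => [cd|cd]; case: eqVneq => [cd'|cd'].
- by move: dd'; rewrite -cd -cd' eqxx.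
- have := @geoP K (c - d'); rewrite subr_eq0 => /(_ cd') [a].
  rewrite -cd !rmorphB /= => E; exists a%:P.
  move: E; set T := geo _ _; rewrite exprS => E.
  have -> : (c%:P - d'%:P) * (1 * ('X * T)) = 'X * ((c%:P - d'%:P + 'X) * T) - 'X * ('X * T).
    by ring.
  by rewrite E; ring.
- have := @geoP K (c - d); rewrite subr_eq0 => /(_ cd) [a].
  rewrite -cd' !rmorphB /= => E; exists (- a%:P).
  move: E; set T := geo _ _; rewrite exprS => E.
  have -> : (d%:P - c%:P) * ('X * T * 1) = 'X * ('X * T) - 'X * ((c%:P - d%:P + 'X) * T).
    by ring.
  by rewrite E; ring.
have := @geoP K (c - d); rewrite subr_eq0 => /(_ cd) [a].
have := @geoP K (c - d'); rewrite subr_eq0 => /(_ cd') [a'].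
rewrite !rmorphB /= => E' E.
move: E E'; set T := geo _ (c - d); set T' := geo _ (c - d'); rewrite exprS => E E'.
exists ('X * (T * a'%:P - T' * a%:P)).
have -> : (d%:P - d'%:P) * ('X * T * ('X * T')) =
  'X * 'X * (T * ((c%:P - d'%:P + 'X) * T') - T' * ((c%:P - d%:P + 'X) * T)).
  by ring.
by rewrite E E'; ring.
Qed.

Lemma loc_coef0 K c d : (loc K c d)`_0 = (c == d)%:R.
Proof. by rewrite /loc; case: eqVneq; rewrite ?coef1 // coefXM. Qed.

(** The product expands (s - c)^n / prod (s - d) with n = [size l], so its coefficient n - 1 is a
    residue at c. Partial fractions on two distinct poles lower n; a single pole of order at least 2
    has no residue. *)
Lemma residue_seq K (D l : seq F) : uniq D -> {subset l <= D} ->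
  (1 < size l <= K)%N ->
  \sum_(c <- D) (\prod_(d <- l) loc K c d)`_(size l).-1 = 0.
Proof.
move=> uD; have [n] := ubnP (size l); elim: n l => // n IH l.
rewrite ltnS => ln lD /andP[l1 lK].
case: l ln lD l1 lK => // d l /= ln lD l1 lK.
case: (boolP (all (pred1 d) l)) => [/all_pred1P El|].
  have {}El : d :: l = nseq (size l).+1 d by rewrite /= -El.
  rewrite big1 // => c _; rewrite El big_nseq iter_mulr_1.
  rewrite /loc; case: eqVneq => _.
    by rewrite expr1n coef1; case: (size l) l1.
  by rewrite exprMn coefXnM ltnSn.
rewrite -has_predC => /hasP[d' d'l /= dd'].
have Pl := perm_to_rem d'l; set l' := rem d' l in Pl.
have sl : size l = (size l').+1 by rewrite (perm_size Pl).
have l'D u : u \in [:: d, d' & l'] -> u \in D.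
  by move=> ul; apply: lD; rewrite inE (perm_mem Pl) -in_cons.
have dd0 : d - d' != 0 by rewrite subr_eq0 eq_sym.
rewrite sl; apply: (mulfI dd0); rewrite mulr0 mulr_sumr.
have step c : (d - d') * (\prod_(d <- d :: l) loc K c d)`_(size l').+1
   = (\prod_(u <- d :: l') loc K c u)`_(size l') - (\prod_(u <- d' :: l') loc K c u)`_(size l').
  rewrite big_cons (perm_big _ Pl) /= !big_cons mulrA -coefCM mulrA.
  have [|V ->] := @locP K c d d'; first by rewrite eq_sym.
  set Q := \prod_(u <- l') _.
  rewrite -coefB -mulrBl mulrDl coefD -mulrA coefXM /= -[X in _ + X]addr0 -!mulrA.
  rewrite coefXnM ifT ?addr0 //.
  by rewrite ltnS -sl ltnW.
rewrite (eq_bigr _ (fun c _ => step c)) big_split /= sumrN.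
(* For [l'] empty the induction hypothesis does not apply: a single simple pole has total residue 1,
   and the two ones cancel. *)
case: (posnP (size l')) => [l'0|l'0].
  move/size0nil: l'0 => l'0; rewrite l'0.
  have S1 u : u \in D -> \sum_(c <- D) (\prod_(v <- [:: u]) loc K c v)`_(size ([::] : seq F)) = 1.
    move=> uDD; rewrite (eq_bigr (fun c => (c == u)%:R)); last first.
      by move=> c _; rewrite big_seq1 loc_coef0.
    rewrite (bigD1_seq u) //= eqxx big1 ?addr0 // => i /negPf ->.
    by [].
  by rewrite !S1 ?subrr ?l'D // !inE eqxx ?orbT.
rewrite (IH (d :: l')) ?(IH (d' :: l')) ?subrr //= -?sl //=; try by rewrite ltnS; lia.
- by move=> u ul; apply: l'D; rewrite inE ul orbT.
- lia.
- by move=> u ul; apply: l'D; move: ul; rewrite !inE => /orP[->|->]; rewrite ?orbT.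
- lia.
Qed.

(* A factor [(p, s)] stands for [\sum_((a, d) <- s) a / (s - d) ^+ p]. *)
Definition loc_sum K c (f : nat * seq (F * F)) : {poly F} :=
  \sum_(t <- f.2) t.1 *: loc K c t.2 ^+ f.1.

Lemma residue_sum0 K (D : seq F) (fs : seq (nat * seq (F * F))) : uniq D ->
  (forall f t, f \in fs -> t \in f.2 -> t.2 \in D) ->
  (1 < \sum_(f <- fs) f.1 <= K)%N ->
  \sum_(c <- D) (\prod_(f <- fs) loc_sum K c f)`_(\sum_(f <- fs) f.1).-1 = 0.
Proof.
move=> uD fD h.
(* Generalised by a list [l] of poles already extracted: expanding [f] at a term [t] moves [f.1]
   copies of [t.2] into [l] and keeps the total degree. *)
suff H (l : seq F) : {subset l <= D} ->
    (1 < size l + \sum_(f <- fs) f.1 <= K)%N ->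
    \sum_(c <- D) (\prod_(d <- l) loc K c d * \prod_(f <- fs) loc_sum K c f)
      `_(size l + \sum_(f <- fs) f.1).-1 = 0.
  apply: (etrans _ (H [::] _ h)) => //.
  by apply: eq_bigr => c _; rewrite big_nil mul1r.
elim: fs fD l {h} => [|f fs IH] fD l lD h.
  rewrite big_nil addn0 in h *.
  under eq_bigr => c _ do rewrite big_nil mulr1.
  exact: residue_seq.
pose lt (t : F * F) := nseq f.1 t.2 ++ l.
have E c : \prod_(d <- l) loc K c d * \prod_(f <- f :: fs) loc_sum K c f
  = \sum_(t <- f.2) t.1 *: (\prod_(d <- lt t) loc K c d * \prod_(f <- fs) loc_sum K c f).
  rewrite big_cons mulrCA {1}/loc_sum mulr_suml; apply: eq_bigr => t _.
  by rewrite /lt big_cat /= big_nseq iter_mulr_1 -scalerAl mulrA.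
set n := (size l + _).-1.
under eq_bigr => c _ do rewrite E coef_sum.
rewrite exchange_big /= big1_seq // => t /andP[_ tf].
under eq_bigr => c _ do rewrite coefZ.
rewrite -mulr_sumr /n big_cons.
have := IH _ (lt t); rewrite size_cat size_nseq -addnA addnCA; rewrite big_cons in h.
move=> -> //; rewrite ?mulr0 //.
- by move=> g t' gfs; apply: fD; rewrite inE gfs orbT.
- by move=> u; rewrite mem_cat => /orP[/nseqP[->] _|/lD //]; apply: fD tf; rewrite inE eqxx.
Qed.


(** (d + X)^-p is homogeneous in d and X, so d enters each coefficient as a pure power. Summed over
    the poles, these powers form the zeta- and t-sums. *)
Lemma coef_geoX K d p e :
  (geo K d ^+ p)`_e = d ^- (p + e) * (geo K 1 ^+ p)`_e.
Proof.
elim: p e => [|p IH] e.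
  by rewrite !expr0 !coef1; case: e => [|e]; rewrite /= ?mulr0 // expr0 invr1 mulr1.
rewrite (exprS (geo K d)) (exprS (geo K 1)) !coefM mulr_sumr; apply: eq_bigr => i _.
rewrite IH /geo !coef_poly; case: ifP => _; last by rewrite !mul0r mulr0.
have -> : d ^- (p.+1 + e) = d ^- i.+1 * d ^- (p + (e - i)).
  by rewrite -invfM -exprD addSn addSn addnCA subnKC // -ltnS.
by rewrite expr1n invr1 mulr1; ring.
Qed.

(** Makes the numerical constants of the expansions admissible as rational coefficients. *)
Lemma coef_geoX_int K p e : exists z : int, (geo K 1 ^+ p)`_e = z%:~R.
Proof.
elim: p e => [|p IH] e.
  by exists (e == 0)%:R; rewrite expr0 coef1; case: eqP.
rewrite exprS coefM; elim/big_ind: _ => [|x y [a ->] [b ->]|i _].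
- by exists 0.
- by exists (a + b); rewrite rmorphD.
have [a ->] := IH (e - i)%N; rewrite /geo coef_poly; case: ifP => _.
  by exists ((-1) ^+ i * a); rewrite expr1n invr1 mulr1 rmorphM rmorphXn rmorphN1.
by exists 0; rewrite mul0r.
Qed.

End Residues.

(** * Limits of complex sequences *)

Section Limits.
Variable R : realType.
Local Notation C := R[i].
Implicit Types (u v : nat -> C) (z l : C) (e : R).

(** The norm of [z] lies in [C]; its real counterpart is open to linear arithmetic over [R]. *)
Definition nm (z : C) : R := Normc.normc z.

Lemma normE z : `|z| = (nm z)%:C%C. Proof. by []. Qed.

Lemma nm_ge0 z : 0 <= nm z.
Proof. by have := normr_ge0 z; rewrite normE -[0]/(0%:C)%C lecR. Qed.

Lemma nmM z z' : nm (z * z') = nm z * nm z'.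
Proof. exact: Normc.normcM. Qed.

Lemma nmV z : nm z^-1 = (nm z)^-1.
Proof. exact: Normc.normcV. Qed.

Lemma nmN z : nm (- z) = nm z.
Proof. by have := normrN z; rewrite !normE => -[]. Qed.

Lemma nmD z z' : nm (z + z') <= nm z + nm z'.
Proof. by have := ler_normD z z'; rewrite !normE -rmorphD lecR. Qed.

Lemma nmB z z' : nm (z - z') <= nm z + nm z'.
Proof. by rewrite -(nmN z'); apply: nmD. Qed.

Lemma nm_dist z z' : nm (z - z') = nm (z' - z).
Proof. by rewrite -nmN opprB. Qed.

Lemma nm0 : nm 0 = 0. Proof. exact: Normc.normc0. Qed.
Lemma nm1 : nm 1 = 1. Proof. exact: Normc.normc1. Qed.

Lemma nm_eq0 z : nm z = 0 -> z = 0. Proof. exact: Normc.eq0_normc. Qed.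

Lemma nmX z n : nm (z ^+ n) = nm z ^+ n.
Proof. by elim: n => [|n IH]; rewrite ?expr0 ?nm1 // !exprS nmM IH. Qed.

Lemma nmR (a : R) : nm a%:C%C = `|a|.
Proof. by rewrite /nm /= expr0n /= addr0 sqrtr_sqr. Qed.

Lemma nm_sum (I : Type) (s : seq I) (P : pred I) (F : I -> C) :
  nm (\sum_(i <- s | P i) F i) <= \sum_(i <- s | P i) nm (F i).
Proof.
elim/big_ind2: _ => [|x1 x2 y1 y2 h1 h2|//]; first by rewrite nm0.
by apply: le_trans (nmD _ _) _; apply: lerD.
Qed.

Lemma Re_nm z : `|complex.Re z| <= nm z.
Proof. by have := normc_ge_Re z; rewrite normE lecR. Qed.

Lemma Im_nm z : `|complex.Im z| <= nm z.
Proof.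
case: z => a b; rewrite /nm /= -sqrtr_sqr ler_wsqrtr // lerDr sqr_ge0 //.
Qed.

Lemma nm_le z : nm z <= `|complex.Re z| + `|complex.Im z|.
Proof.
case: z => a b; rewrite /nm /= -[leRHS]ger0_norm ?addr_ge0 // -sqrtr_sqr.
rewrite ler_wsqrtr // sqrrD !real_normK ?num_real // -addrA lerD2l lerDr.
by rewrite mulrn_wge0 // mulr_ge0.
Qed.

Definition tends u l :=
  forall e, 0 < e -> exists K, forall n, (K <= n)%N -> nm (u n - l) < e.

Lemma tendsP u l : tends u l <-> (u : nat -> C^o) @ \oo --> (l : C^o).
Proof.
split=> [h|/cvgrPdist_lt h e e0].
  apply/cvgrPdist_lt => e e0.
  have [a0 aE] : 0 < complex.Re e /\ e = (complex.Re e)%:C%C.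
    by case: e e0 => a b; rewrite ltcE /= => /andP[/eqP -> ?]; split.
  have [K hK] := h _ a0; exists K => // n /= Kn.
  by rewrite aE normE ltcR nm_dist hK.
have /h : 0 < e%:C%C by rewrite -[0]/(0%:C)%C ltcR.
move=> [K _ hK]; exists K => n Kn.
by have := hK n Kn; rewrite /= normE ltcR nm_dist.
Qed.

Lemma tends_climn u l : tends u l -> climn u = l.
Proof. by move/tendsP => h; apply: (@cvg_lim C^o (@norm_hausdorff _ _) _ _ _ _ _ h). Qed.

Lemma tends_uniq u l l' : tends u l -> tends u l' -> l = l'.
Proof. by move=> /tends_climn <- /tends_climn. Qed.

Lemma tends_cst z : tends (fun=> z) z.
Proof. by move=> e e0; exists 0%N => n _; rewrite subrr nm0. Qed.

Lemma tends_ext u v l : u =1 v -> tends u l -> tends v l.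
Proof. by move=> h hu e /hu [K hK]; exists K => n /hK; rewrite h. Qed.

Lemma tends_eq u l l' : l = l' -> tends u l -> tends u l'.
Proof. by move=> ->. Qed.

Lemma tendsD u v l l' : tends u l -> tends v l' ->
  tends (fun n => u n + v n) (l + l').
Proof. by move=> /tendsP h /tendsP h'; apply/tendsP; exact: cvgD h h'. Qed.

Lemma tendsM u v l l' : tends u l -> tends v l' ->
  tends (fun n => u n * v n) (l * l').
Proof. by move=> /tendsP h /tendsP h'; apply/tendsP; exact: cvgM h h'. Qed.

Lemma tendsZ z u l : tends u l -> tends (fun n => z * u n) (z * l).
Proof. by apply: tendsM; exact: tends_cst. Qed.

Lemma tendsN u l : tends u l -> tends (fun n => - u n) (- l).
Proof. by move=> /(tendsZ (-1)); rewrite mulN1r; apply: tends_ext => n; rewrite mulN1r. Qed.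

Lemma tendsB u v l l' : tends u l -> tends v l' ->
  tends (fun n => u n - v n) (l - l').
Proof. by move=> hu /tendsN; exact: tendsD. Qed.

Lemma tends_sum (I : Type) (s : seq I) (F : nat -> I -> C) (f : I -> C) :
  (forall i, tends (F ^~ i) (f i)) ->
  tends (fun n => \sum_(i <- s) F n i) (\sum_(i <- s) f i).
Proof.
move=> h; elim: s => [|i s IH].
  by rewrite big_nil; apply: tends_ext (tends_cst 0) => n; rewrite big_nil.
rewrite big_cons; apply: tends_ext (tendsD (h i) IH) => n; by rewrite big_cons.
Qed.

Lemma tends_prod (I : Type) (s : seq I) (F : nat -> I -> C) (f : I -> C) :
  (forall i, tends (F ^~ i) (f i)) ->
  tends (fun n => \prod_(i <- s) F n i) (\prod_(i <- s) f i).
Proof.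
move=> h; elim: s => [|i s IH].
  by rewrite big_nil; apply: tends_ext (tends_cst 1) => n; rewrite big_nil.
rewrite big_cons; apply: tends_ext (tendsM (h i) IH) => n; by rewrite big_cons.
Qed.

Lemma tends_comp (f : nat -> nat) u l : (forall K, exists K', forall n, (K' <= n)%N -> (K <= f n)%N) ->
  tends u l -> tends (u \o f) l.
Proof.
move=> hf hu e /hu [K hK]; have [K' h'] := hf K.
by exists K' => n /h' /hK.
Qed.

Lemma tends_shift k u l : tends u l -> tends (fun n => u (n + k)%N) l.
Proof.
by apply: (@tends_comp (addn^~ k)) => K; exists K => n Kn; rewrite (leq_trans Kn) // leq_addr.
Qed.

Lemma tends_unshift k u l : tends (fun n => u (n + k)%N) l -> tends u l.
Proof.
move=> h e /h [K hK]; exists (K + k)%N => n Kn.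
have kn : (k <= n)%N by apply: leq_trans Kn; exact: leq_addl.
by rewrite -(subnK kn) hK // leq_subRL // addnC.
Qed.

Lemma tends_sub k u l : tends u l -> tends (fun n => u (n - k)%N) l.
Proof.
apply: (@tends_comp (subn^~ k)) => K; exists (K + k)%N => n Kn; lia.
Qed.

Lemma tends_nm_le u l (c : R) : (forall n, nm (u n) <= c) -> tends u l -> nm l <= c.
Proof.
move=> hu ul; apply/ler_addgt0Pr => e /ul [K /(_ K (leqnn K))] hK.
have -> : l = u K - (u K - l) by rewrite opprB addrC subrK.
by apply: le_trans (nmB _ _) _; apply: lerD => //; exact: ltW.
Qed.

Lemma cauchy_tends u :
  (forall e, 0 < e -> exists K, forall n, (K <= n)%N -> nm (u n - u K) < e) ->
  exists l, tends u l.
Proof.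
move=> h.
have aux (p : C -> R) : (forall z z', p (z - z') = p z - p z') ->
    (forall z, `|p z| <= nm z) -> cvg ((p \o u : R^nat) @ \oo).
  move=> pB ple; apply/cauchy_cvgP/cauchy_exP => e e0.
  have [K hK] := h _ e0; exists (p (u K)); exists K => // n /= Kn.
  rewrite -ball_normE /= -pB (le_lt_trans (ple _)) // nm_dist.
  exact: hK.
have /cvg_ex[/= a /cvgrPdist_lt ha] := aux (@complex.Re R) (fun z z' => raddfB _ z z') Re_nm.
have /cvg_ex[/= b /cvgrPdist_lt hb] := aux (@complex.Im R) (fun z z' => raddfB _ z z') Im_nm.
exists (a +i* b)%C => e e0.
have e2 : 0 < e / 2 by rewrite divr_gt0.
have [K1 _ h1] := ha _ e2; have [K2 _ h2] := hb _ e2.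
exists (maxn K1 K2) => n; rewrite geq_max => /andP[n1 n2].
apply: le_lt_trans (nm_le _) _; rewrite (splitr e).
have := h1 n n1; have := h2 n n2 => /=; rewrite distrC => k2; rewrite distrC => k1.
by case: (u n) k1 k2 => c d /= k1 k2; rewrite ltrD.
Qed.
End Limits.

(** * Uniform Abel summation *)

Section Tame.
Variable R : realType.
Local Notation C := R[i].
Implicit Types (y z : C) (q : nat) (B d : R) (f : nat -> C) (G : nat -> nat -> C).

Lemma nm_unity y : is_unity_root y -> nm y = 1.
Proof.
move=> [n n0]; rewrite unity_rootE => /eqP/(congr1 (@nm R)); rewrite nmX nm1 => /eqP.
by rewrite pexpr_eq1 ?nm_ge0 // => /eqP.
Qed.

(** With indices starting at 0, [d = 1] gives the weights of S-sums and zeta-sums, [d = 1/2] those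
    of R-sums and t-sums. *)
Definition wt d q y (n : nat) : C := y ^+ n / (n%:R + d%:C%C) ^+ q.

Lemma nm_natD d n : 0 <= d -> nm (n%:R + d%:C%C) = n%:R + d.
Proof.
move=> d0; rewrite -[n%:R](rmorph_nat (real_complex R)) -rmorphD nmR ger0_norm //.
by rewrite addr_ge0.
Qed.

Lemma nm_wt d q y n : 0 <= d -> is_unity_root y ->
  nm (wt d q y n) = (n%:R + d) ^- q.
Proof.
by move=> d0 hy; rewrite nmM nmV !nmX nm_unity // expr1n mul1r nm_natD.
Qed.

(** Telescoping: (n + 1/2)^2 exceeds n(n + 1), and 1/(n(n + 1)) = 1/n - 1/(n + 1). *)
Lemma sum_invsq (K L : nat) : (0 < K <= L)%N ->
  \sum_(K <= n < L) (n%:R + 2^-1 : R) ^- 2 <= K%:R^-1 - L%:R^-1.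
Proof.
move=> /andP[K0 /subnKC <-]; elim: (L - K)%N => [|m IH].
  by rewrite addn0 big_geq // subrr.
rewrite addnS big_nat_recr /=; last exact: leq_addr.
set n := (K + m)%N in IH *.
have n0 : (0 : R) < n%:R by rewrite ltr0n /n ltn_addr.
have step : (n%:R + 2^-1 : R) ^- 2 <= n%:R^-1 - n.+1%:R^-1.
  have -> : n%:R^-1 - n.+1%:R^-1 = (n%:R * (n%:R + 1))^-1 :> R.
    by rewrite -natr1; field; apply/andP; split; lra.
  by rewrite lef_pV2 ?posrE; nra.
by apply: le_trans (lerD IH step) _; rewrite addrA subrK.
Qed.

Lemma sum_invsq_le (K L : nat) : (0 < K)%N ->
  \sum_(K <= n < L) (n%:R + 2^-1 : R) ^- 2 <= K%:R^-1.
Proof.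
move=> K0; have [KL|LK] := leqP K L.
  apply: le_trans (sum_invsq _) _; first by rewrite K0.
  by rewrite gerBl invr_ge0.
by rewrite big_geq ?(ltnW LK) // invr_ge0.
Qed.

Lemma sum_invsq_bound L : \sum_(0 <= n < L) (n%:R + 2^-1 : R) ^- 2 <= 5.
Proof.
case: L => [|L]; first by rewrite big_geq.
rewrite big_nat_recl // add0r -(big_add1 _ _ 0%N L.+1 xpredT (fun n => (n%:R + 2^-1 : R) ^- 2)).
have := @sum_invsq_le 1 L.+1 isT; rewrite invr1.
have -> : (2^-1 : R) ^- 2 = 4 by field.
lra.
Qed.

Lemma summation_by_parts y (g : nat -> C) (K L : nat) : (K <= L)%N ->
  (y - 1) * \sum_(K <= n < L) y ^+ n * g n =
  y ^+ L * g L - y ^+ K * g K - \sum_(K <= n < L) y ^+ n.+1 * (g n.+1 - g n).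
Proof.
move=> /subnKC <-; elim: (L - K)%N => [|m IH].
  by rewrite addn0 !big_geq // mulr0 !subrr.
rewrite addnS !big_nat_recr ?leq_addr //= mulrDr IH exprS; ring.
Qed.

(* The square-summability of the increments is stable under translation of the
   index, which makes the bounds below uniform over shifted sequences. *)
Definition tame1 B f :=
  (forall n, nm (f n) <= B) /\
  (forall L, \sum_(0 <= n < L) nm (f n.+1 - f n) ^+ 2 <= B).

Lemma tame1_ge0 B f : tame1 B f -> 0 <= B.
Proof. by move=> [/(_ 0%N) + _]; apply: le_trans; exact: nm_ge0. Qed.

Lemma tame1_sum B f (K L : nat) : tame1 B f ->
  \sum_(K <= n < L) nm (f n.+1 - f n) ^+ 2 <= B.
Proof.
move=> hf; have [LK|KL] := leqP L K; first by rewrite big_geq // (tame1_ge0 hf).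
apply: le_trans (hf.2 L); rewrite (@big_cat_nat _ _ _ K 0 L) //=; last exact: ltnW.
by rewrite lerDr sumr_ge0 // => i _; rewrite sqr_ge0.
Qed.

(** [A] is chosen before [B] and [f], so the tail is uniform over a family with a common bound. For
    q >= 2 the series converges absolutely; for q = 1 one has y != 1, and Abel summation moves the
    difference onto f(n)/(n + d). *)
Lemma wt_tail d q y : 2^-1 <= d -> is_unity_root y -> (0 < q)%N ->
  (q, y) <> (1%N, 1) ->
  exists2 A, 0 <= A & forall B f, tame1 B f -> forall k K L : nat, (0 < k)%N ->
  (k ^ 2 <= K)%N -> (K <= L)%N ->
  nm (\sum_(K <= n < L) wt d q y n * f n) <= A * (B + 1) / k%:R.
Proof.
move=> hd hy q0 qy1; have d0 : 0 <= d by lra.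
have Kk (k K : nat) : (0 < k)%N -> (k ^ 2 <= K)%N ->
    [/\ (0 < K)%N, K%:R^-1 <= k%:R^-1 :> R & k%:R * K%:R^-1 <= k%:R^-1 :> R].
  move=> k0 kK; have K0 : (0 < K)%N by apply: leq_trans kK; rewrite expn_gt0 k0.
  have kp : 0 < k%:R :> R by rewrite ltr0n.
  have Kp : 0 < K%:R :> R by rewrite ltr0n.
  split=> //.
    by rewrite lef_pV2 ?posrE // ler_nat; apply: leq_trans kK; rewrite -{1}(expn1 k) leq_pexp2l.
  rewrite ler_pdivrMr // ler_pdivlMl // -expr2 -natrX ler_nat //.
have [q1|q2] := eqVneq q 1%N; last first.
  exists 1 => // B f hf k K L k0 kK KL; have B0 := tame1_ge0 hf.
  have [K0 Kk1 _] := Kk _ _ k0 kK.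
  apply: le_trans (nm_sum _ _ _) _.
  apply: (@le_trans _ _ (B * \sum_(K <= n < L) (n%:R + 2^-1 : R) ^- 2)).
    rewrite mulr_sumr; apply: ler_sum_nat => n /andP[Kn _].
    rewrite nmM mulrC ler_pM ?nm_ge0 //; first exact: hf.1.
    have n1 : 1 <= n%:R :> R by rewrite ler1n (leq_trans K0).
    rewrite nm_wt // lef_pV2 ?posrE ?exprn_gt0 //; try lra.
    apply: (@le_trans _ _ ((n%:R + d) ^+ 2)); first by rewrite lerXn2r ?nnegrE; lra.
    by rewrite ler_weXn2l //; [lra|lia].
  apply: le_trans (ler_wpM2l B0 (sum_invsq_le L K0)) _.
  by rewrite mul1r ler_pM ?invr_ge0 ?lerDl.
have y1 : y - 1 != 0 by apply/eqP => /subr0_eq y1; apply: qy1; rewrite q1 y1.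
have ny0 : 0 < nm (y - 1).
  by rewrite lt_def nm_ge0 andbT; apply/eqP => /nm_eq0/eqP; exact/negP.
(* The boundary terms give 2B/K, the variation of 1/(n + d) gives B/K and the increments of [f] give
   (B + 1)/(2k); since K >= k, the bound 4(B + 1)/k covers them all. *)
exists (4 * (nm (y - 1))^-1) => [|B f hf k K L k0 kK KL].
  by rewrite mulr_ge0 // invr_ge0 nm_ge0.
have B0 := tame1_ge0 hf; have [K0 Kk1 Kk2] := Kk _ _ k0 kK.
pose g n := f n / (n%:R + d%:C%C).
have -> : \sum_(K <= n < L) wt d q y n * f n = \sum_(K <= n < L) y ^+ n * g n.
  by apply: eq_bigr => n _; rewrite /wt /g q1 expr1; ring.
set S := \sum_(K <= n < L) _.
have nmS : nm S = nm ((y - 1) * S) / nm (y - 1) by rewrite nmM mulrAC divff ?mul1r ?gt_eqF.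
rewrite nmS summation_by_parts // mulrAC [4 * _]mulrC -!mulrA mulrC ler_pM2l ?invr_gt0 //.
have ng n : (K <= n)%N -> nm (g n) <= B / K%:R.
  move=> Kn; rewrite nmM nmV nm_natD // ler_pM ?nm_ge0 ?invr_ge0 ?addr_ge0 //; first exact: hf.1.
  rewrite lef_pV2 ?posrE ?ltr0n // ?ltr_wpDl ?ltr0n //; last by lra.
  have : K%:R <= n%:R :> R by rewrite ler_nat.
  by lra.
have nymul n z : nm (y ^+ n * z) = nm z by rewrite nmM nmX nm_unity // expr1n mul1r.
apply: le_trans (nmB _ _) _.
apply: (@le_trans _ _ (2 * (B / K%:R) + (B / K%:R + (B + 1) / (2 * k%:R)))); last first.
  have kp : 0 < k%:R :> R by rewrite ltr0n.
  have : B / K%:R <= B / k%:R by apply: ler_wpM2l.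
  have -> : (B + 1) / (2 * k%:R) = (B + 1) / k%:R / 2 by field; lra.
  have : 0 <= 1 / k%:R :> R by rewrite mul1r invr_ge0; lra.
  have : 0 <= B / k%:R by rewrite divr_ge0.
  rewrite [(_ + _) / _]mulrDl [_^-1 * (_ + _)]mulrDr [_^-1 * B]mulrC !mul1r mulr1.
  move: (B / K%:R) (B / k%:R) (k%:R^-1) => a b c; lra.
apply: lerD.
  apply: le_trans (nmB _ _) _; rewrite !nymul.
  have := ng _ KL; have := ng _ (leqnn K); lra.
apply: le_trans (nm_sum _ _ _) _.
pose h n := (n%:R + 2^-1 : R)^-1.
apply: (@le_trans _ _ (\sum_(K <= n < L) (B * h n ^+ 2 +
   ((2 * k%:R)^-1 * nm (f n.+1 - f n) ^+ 2 + k%:R / 2 * h n ^+ 2)))).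
  apply: ler_sum_nat => n /andP[Kn nL]; rewrite nymul.
  have n0 : 0 <= n%:R :> R by [].
  have n1 : n.+1%:R = n%:R + 1 :> R by rewrite natr1.
  have nd0 : (n%:R + d%:C%C) != 0 :> C.
    by apply/eqP => /(congr1 (@nm R)); rewrite nm_natD // nm0; lra.
  have nd1 : (n.+1%:R + d%:C%C) != 0 :> C.
    by apply/eqP => /(congr1 (@nm R)); rewrite nm_natD // nm0; lra.
  have -> : g n.+1 - g n = (f n.+1 - f n) / (n.+1%:R + d%:C%C)
     - f n * (n.+1%:R + d%:C%C)^-1 * (n%:R + d%:C%C)^-1.
    by rewrite /g; move: nd1; rewrite -natr1 => nd1; field; apply/andP; split.
  apply: le_trans (nmB _ _) _; rewrite !nmM !nmV !nm_natD //.
  have hn1 : (n.+1%:R + d)^-1 <= h n by rewrite /h lef_pV2 ?posrE; lra.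
  have hn0 : (n%:R + d)^-1 <= h n by rewrite /h lef_pV2 ?posrE; lra.
  have h0 : 0 <= h n by rewrite /h invr_ge0; lra.
  have p1 : 0 <= (n.+1%:R + d)^-1 by rewrite invr_ge0; lra.
  have p0 : 0 <= (n%:R + d)^-1 by rewrite invr_ge0; lra.
  rewrite addrC -mulrA; apply: lerD.
    apply: ler_pM; rewrite ?nm_ge0 ?mulr_ge0 //; first exact: hf.1.
    by rewrite expr2; apply: ler_pM.
  set u := nm _; have u0 : 0 <= u by exact: nm_ge0.
  apply: (@le_trans _ _ (u * h n)); first by apply: ler_wpM2l.
  have kp : 0 < k%:R :> R by rewrite ltr0n.
  (* Weighted inequality u h <= u^2/(2k) + k h^2/2. The first part sums to at most B/(2k), the
     second to at most k/(2K), and K >= k^2 makes this at most 1/(2k). *)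
  rewrite -subr_ge0.
  have -> : (2 * k%:R)^-1 * u ^+ 2 + k%:R / 2 * h n ^+ 2 - u * h n =
     (u - k%:R * h n) ^+ 2 / (2 * k%:R) by field; lra.
  by rewrite divr_ge0 ?sqr_ge0 //; lra.
rewrite !big_split /= -!mulr_sumr.
have hsq : \sum_(K <= n < L) h n ^+ 2 <= K%:R^-1.
  apply: le_trans (sum_invsq_le L K0); rewrite le_eqVlt; apply/orP; left; apply/eqP.
  by apply: eq_bigr => n _; rewrite /h exprVn.
apply: lerD; first exact: ler_wpM2l.
have kp : 0 < k%:R :> R by rewrite ltr0n.
have -> : (B + 1) / (2 * k%:R) = (2 * k%:R)^-1 * B + 2^-1 * k%:R^-1 by field; lra.
apply: lerD.
  by apply: ler_wpM2l; [rewrite invr_ge0; lra|exact: tame1_sum].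
apply: (@le_trans _ _ (2^-1 * (k%:R * K%:R^-1))); last by apply: ler_wpM2l => //; lra.
rewrite mulrA [2^-1 * _]mulrC; apply: ler_wpM2l => //; lra.
Qed.
End Tame.

(** * Tannery's theorem for tame families *)

Section Tannery.
Variable R : realType.
Local Notation C := R[i].
Implicit Types (y z : C) (q : nat) (B d : R) (f g : nat -> C) (G : nat -> nat -> C).

Definition tame G := exists B, forall M, tame1 B (G M).

Lemma tame_ext G G' : G =2 G' -> tame G -> tame G'.
Proof.
move=> h [B hB]; exists B => M; split=> [n|L]; first by rewrite -h; exact: (hB M).1.
by under eq_bigr do rewrite -!h; exact: (hB M).2.
Qed.

Lemma tame_cst z : tame (fun _ _ => z).
Proof.
exists (nm z) => M; split=> // L.
by rewrite big1 ?nm_ge0 // => i _; rewrite subrr nm0 expr0n.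
Qed.

Lemma nmD_sqr z z' : nm (z + z') ^+ 2 <= 2 * (nm z ^+ 2 + nm z' ^+ 2).
Proof.
have := nmD z z'; have := nm_ge0 (z + z'); have := nm_ge0 z; have := nm_ge0 z'.
move: (nm _) (nm z) (nm z') => a b c *.
have : a ^+ 2 <= (b + c) ^+ 2 by rewrite lerXn2r ?nnegrE //; lra.
have := sqr_ge0 (b - c); rewrite sqrrB sqrrD; lra.
Qed.

Lemma tameD G G' : tame G -> tame G' -> tame (fun M n => G M n + G' M n).
Proof.
move=> [B h] [B' h']; exists (2 * (B + B')) => M.
have B0 := tame1_ge0 (h M); have B0' := tame1_ge0 (h' M).
split=> [n|L].
  apply: le_trans (nmD _ _) _; have := (h M).1 n; have := (h' M).1 n; lra.
apply: (@le_trans _ _ (\sum_(0 <= n < L) 2 * (nm (G M n.+1 - G M n) ^+ 2 + nm (G' M n.+1 - G' M n) ^+ 2))).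
  by apply: ler_sum => n _; rewrite opprD addrACA; exact: nmD_sqr.
rewrite -mulr_sumr big_split /= ler_wpM2l //.
by apply: lerD; [exact: (h M).2|exact: (h' M).2].
Qed.

Lemma tameM G G' : tame G -> tame G' -> tame (fun M n => G M n * G' M n).
Proof.
move=> [B h] [B' h']; exists (B * B' + 2 * (B ^+ 2 * B' + B' ^+ 2 * B)) => M.
have B0 := tame1_ge0 (h M); have B0' := tame1_ge0 (h' M).
have a0 : 0 <= B * B' by exact: mulr_ge0.
have b0 : 0 <= B ^+ 2 * B' by rewrite mulr_ge0 ?sqr_ge0.
have c0 : 0 <= B' ^+ 2 * B by rewrite mulr_ge0 ?sqr_ge0.
split=> [n|L].
  rewrite nmM; apply: (@le_trans _ _ (B * B')); last by lra.
  by apply: ler_pM; rewrite ?nm_ge0 //; [exact: (h M).1|exact: (h' M).1].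
apply: (@le_trans _ _ (\sum_(0 <= n < L) 2 * (B ^+ 2 * nm (G' M n.+1 - G' M n) ^+ 2 + B' ^+ 2 * nm (G M n.+1 - G M n) ^+ 2))).
  apply: ler_sum => n _.
  have -> : G M n.+1 * G' M n.+1 - G M n * G' M n =
     G M n.+1 * (G' M n.+1 - G' M n) + G' M n * (G M n.+1 - G M n) by ring.
  apply: le_trans (nmD_sqr _ _) _; rewrite ler_wpM2l // !nmM !exprMn.
  by apply: lerD; rewrite ler_wpM2r ?sqr_ge0 // lerXn2r ?nnegrE ?nm_ge0 //;
    [exact: (h M).1|exact: (h' M).1].
rewrite -mulr_sumr big_split /= -!mulr_sumr.
apply: (@le_trans _ _ (2 * (B ^+ 2 * B' + B' ^+ 2 * B))); last by lra.
rewrite ler_wpM2l //; apply: lerD; rewrite ler_wpM2l ?sqr_ge0 //.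
  exact: (h' M).2.
exact: (h M).2.
Qed.

Lemma tameZ z G : tame G -> tame (fun M n => z * G M n).
Proof. exact/tameM/tame_cst. Qed.

Lemma tame_prod (I : Type) (s : seq I) (F : I -> nat -> nat -> C) :
  (forall i, tame (F i)) -> tame (fun M n => \prod_(i <- s) F i M n).
Proof.
move=> h; elim: s => [|i s IH].
  by apply: tame_ext (tame_cst 1) => M n; rewrite big_nil.
by apply: tame_ext (tameM (h i) IH) => M n; rewrite big_cons.
Qed.

Lemma tame_sum (I : Type) (s : seq I) (F : I -> nat -> nat -> C) :
  (forall i, tame (F i)) -> tame (fun M n => \sum_(i <- s) F i M n).
Proof.
move=> h; elim: s => [|i s IH].
  by apply: tame_ext (tame_cst 0) => M n; rewrite big_nil.
by apply: tame_ext (tameD (h i) IH) => M n; rewrite big_cons.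
Qed.

(** * Shift, reversal and delay of a tame sequence *)

Section Reindexed.
Variables (B : R) (f : nat -> C) (hf : tame1 B f).

Lemma tame_id : tame (fun _ n => f n).
Proof. by exists B. Qed.

Lemma tame_shift : tame (fun M n => f (n + M)%N).
Proof.
exists B => M; split=> [n|L]; first exact: hf.1.
have := tame1_sum M (L + M) hf; rewrite -{1}(add0n M) big_addn addnK.
by under eq_bigr do rewrite -addSn.
Qed.

(** Truncated subtraction makes the row constant beyond n = M; before that it runs through the
    increments of [f] below M, each once and with opposite sign. *)
Lemma tame_rev : tame (fun M n => f (M - n)%N).
Proof.
exists B => M; split=> [n|L]; first exact: hf.1.
suff : \sum_(0 <= n < L) nm (f (M - n.+1)%N - f (M - n)%N) ^+ 2
  <= \sum_(0 <= n < M) nm (f n.+1 - f n) ^+ 2 by move/le_trans; apply; exact: hf.2.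
elim: M L => [|M IH] L.
  by rewrite [leRHS]big_geq // big1 // => n _; rewrite !sub0n subrr nm0 expr0n.
case: L => [|L].
  by rewrite big_geq // sumr_ge0 // => n _; rewrite sqr_ge0.
rewrite big_nat_recl // big_nat_recr //= subn0 subSS subn0 nm_dist [leLHS]addrC lerD2r.
by under eq_bigr do rewrite !subSS; exact: IH.
Qed.

Lemma tame_delay : tame (fun M n => f (n - M)%N).
Proof.
exists B => M; split=> [n|L]; first exact: hf.1.
suff : \sum_(0 <= n < L) nm (f (n.+1 - M)%N - f (n - M)%N) ^+ 2
  <= \sum_(0 <= n < L - M) nm (f n.+1 - f n) ^+ 2 by move/le_trans; apply; exact: hf.2.
elim: L => [|L IH]; first by rewrite !big_geq.
rewrite big_nat_recr //=; have [LM|ML] := ltnP L M.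
  rewrite (_ : L - M = 0)%N; last by lia.
  rewrite (_ : L.+1 - M = 0)%N in IH *; last by lia.
  rewrite subrr nm0 expr0n addr0 (le_trans IH) //.
  by rewrite (_ : L - M = 0)%N //; lia.
by rewrite subSn // big_nat_recr //= lerD2r.
Qed.

End Reindexed.

Definition wsum d q y f (N : nat) : C := \sum_(0 <= n < N) wt d q y n * f n.

Lemma natinv_lt (A e : R) : 0 < e -> exists2 k : nat, (0 < k)%N & A / k%:R < e.
Proof.
move=> e0; exists (Num.bound `|A / e|).+1 => //.
rewrite ltr_pdivrMr ?ltr0n // mulrC -ltr_pdivrMr //.
apply: le_lt_trans (ler_norm _) _; apply: lt_trans (archi_boundP _) _ => //.
by rewrite ltr_nat.
Qed.

Lemma wsumB d q y f (K N : nat) : (K <= N)%N ->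
  wsum d q y f N - wsum d q y f K = \sum_(K <= n < N) wt d q y n * f n.
Proof.
by move=> KN; rewrite /wsum (@big_cat_nat _ _ _ K 0 N) //= [LHS]addrC addKr.
Qed.

(** The tail bound is the same for all rows and passes to their pointwise limit [g]. So every series
    is Cauchy, and comparing rows and limit at one common cut-off [K] gives an argument with three
    errors below e/3. *)
Lemma tannery d q y G g : 2^-1 <= d -> is_unity_root y -> (0 < q)%N ->
  (q, y) <> (1%N, 1) -> tame G -> (forall n, tends (G ^~ n) (g n)) ->
  exists s l, [/\ forall M, tends (wsum d q y (G M)) (s M), tends s l &
                  tends (wsum d q y g) l].
Proof.
move=> hd hy q0 qy1 [B hB] hG.
have [A A0 hA] := wt_tail hd hy q0 qy1.
have tail_g (k K N : nat) : (0 < k)%N -> (k ^ 2 <= K)%N -> (K <= N)%N ->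
    nm (wsum d q y g N - wsum d q y g K) <= A * (B + 1) / k%:R.
  move=> k0 kK KN; rewrite wsumB //.
  apply: (@tends_nm_le _ (fun M => \sum_(K <= n < N) wt d q y n * G M n)).
    by move=> M; exact: hA.
  by apply: tends_sum => n; apply: tendsZ; exact: hG.
have tail_G M (k K N : nat) : (0 < k)%N -> (k ^ 2 <= K)%N -> (K <= N)%N ->
    nm (wsum d q y (G M) N - wsum d q y (G M) K) <= A * (B + 1) / k%:R.
  by move=> k0 kK KN; rewrite wsumB //; exact: hA.
have conv f : (forall k K N : nat, (0 < k)%N -> (k ^ 2 <= K)%N -> (K <= N)%N ->
    nm (wsum d q y f N - wsum d q y f K) <= A * (B + 1) / k%:R) ->
    exists l, tends (wsum d q y f) l.
  move=> tf; apply: cauchy_tends => e e0; have [k k0 hk] := natinv_lt (A * (B + 1)) e0.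
  by exists (k ^ 2)%N => n kn; apply: le_lt_trans hk; exact: tf.
have [l hl] := conv _ tail_g.
have /choice[s hs] : forall M, exists l, tends (wsum d q y (G M)) l.
  by move=> M; exact/conv/tail_G.
exists s, l; split=> // e e0.
have e3 : 0 < e / 3 by rewrite divr_gt0.
have [k k0 hk] := natinv_lt (A * (B + 1)) e3; pose K := (k ^ 2)%N.
have lim_tail f l' : (forall N, (K <= N)%N ->
    nm (wsum d q y f N - wsum d q y f K) <= A * (B + 1) / k%:R) ->
    tends (wsum d q y f) l' -> nm (l' - wsum d q y f K) <= A * (B + 1) / k%:R.
  move=> hf fl; apply: (@tends_nm_le _ (fun N => wsum d q y f (N + K) - wsum d q y f K)).
    by move=> N; apply: hf; exact: leq_addl.
  by apply: tendsB (tends_cst _); exact: tends_shift.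
have : tends (fun M => wsum d q y (G M) K) (wsum d q y g K).
  by apply: tends_sum => n; apply: tendsZ; exact: hG.
move=> /(_ _ e3)[M0 hM0]; exists M0 => M /hM0 hM.
have -> : s M - l = (s M - wsum d q y (G M) K) +
  ((wsum d q y (G M) K - wsum d q y g K) - (l - wsum d q y g K)) by ring.
apply: le_lt_trans (nmD _ _) _; have := nmB (wsum d q y (G M) K - wsum d q y g K) (l - wsum d q y g K).
have := lim_tail _ _ (fun N => @tail_G M k K N k0 (leqnn _)) (hs M).
have := lim_tail _ _ (fun N => @tail_g k K N k0 (leqnn _)) hl.
lra.
Qed.

Lemma wsum_tends d q y f B : 2^-1 <= d -> is_unity_root y -> (0 < q)%N ->
  (q, y) <> (1%N, 1) -> tame1 B f -> exists l, tends (wsum d q y f) l.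
Proof.
move=> hd hy q0 qy1 hf.
have [|s [l [_ _ h]]] := @tannery d q y (fun=> f) f hd hy q0 qy1 (tame_id hf).
  by move=> n; exact: tends_cst.
by exists l.
Qed.

(** The reason for squares in [tame1]: for q = 1 the increments have size 1/n, which is
    square-summable only. Boundedness is the tail estimate for a constant sequence. *)
Lemma tame1_wsum1 d q y : 2^-1 <= d -> is_unity_root y -> (0 < q)%N ->
  (q, y) <> (1%N, 1) -> exists B, tame1 B (wsum d q y (fun=> 1)).
Proof.
move=> hd hy q0 qy1; have d0 : 0 <= d by lra.
have [A A0 hA] := wt_tail hd hy q0 qy1.
have h1 : tame1 1 (fun=> 1 : C).
  by split=> [n|L]; rewrite ?nm1 // big1 // => i _; rewrite subrr nm0 expr0n.
have sq n : nm (wsum d q y (fun=> 1) n.+1 - wsum d q y (fun=> 1) n) = (n%:R + d) ^- q.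
  by rewrite wsumB // big_nat1 mulr1 nm_wt.
have B0 : 0 <= d ^- q by rewrite invr_ge0 exprn_ge0.
have Dq : 0 <= (d ^- q) ^+ 2 by rewrite sqr_ge0.
(* In order: the first summand, the tail from index 1 (with k = B = 1), the square of the first
   increment, and the squares of all later ones. *)
exists (d ^- q + A * (1 + 1) + (d ^- q) ^+ 2 + 5); split=> [[|n]|[|L]].
- rewrite /wsum big_geq // nm0; lra.
- rewrite -(subrK (wsum d q y (fun=> 1) 1) (wsum _ _ _ _ _)).
  have := hA _ _ h1 1%N 1%N n.+1 isT isT isT; rewrite invr1 mulr1 -wsumB // => h.
  have := sq 0%N; rewrite /wsum [X in nm (_ - X)]big_geq // subr0 add0r => h0.
  by apply: le_trans (nmD _ _) _; rewrite h0; move: h; rewrite /wsum; lra.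
- rewrite big_geq //; lra.
rewrite big_nat_recl // sq add0r.
have : \sum_(0 <= i < L) nm (wsum d q y (fun=> 1) i.+2 - wsum d q y (fun=> 1) i.+1) ^+ 2 <= 5.
  apply: le_trans (sum_invsq_bound R L.+1); rewrite big_nat_recl //.
  apply: ler_wpDl; first by rewrite invr_ge0 sqr_ge0.
  apply: ler_sum => i _; rewrite sq exprVn lef_pV2 ?posrE; last first.
  - by rewrite exprn_gt0 //; have : 0 <= i.+1%:R :> R by []; lra.
  - by rewrite !exprn_gt0 //; have : 0 <= i.+1%:R :> R by []; lra.
  have i1 : 1 <= i.+1%:R :> R by rewrite ler1n.
  rewrite lerXn2r ?nnegrE ?exprn_ge0 //; try lra.
  apply: (@le_trans _ _ (i.+1%:R + d)); first by lra.
  by rewrite -[leLHS]expr1 ler_weXn2l //; lra.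
have := mulr_ge0 A0 (ler0n R 2); lra.
Qed.
End Tannery.

(** * Normal forms and combinations of Euler sums *)

Section EulerSums.
Variable R : realType.
Local Notation C := R[i].
Implicit Types (y z c : C) (q : nat) (B d : R) (f g : nat -> C) (u : nat * C).

Definition regular u := [/\ (0 < u.1)%N, is_unity_root u.2 & u <> (1%N, 1)].

Lemma unity_neq0 y : is_unity_root y -> y != 0.
Proof. by move=> /nm_unity h; apply/eqP => y0; move: h; rewrite y0 nm0; lra. Qed.

Lemma unityV y : is_unity_root y -> is_unity_root y^-1.
Proof.
move=> [n n0]; rewrite unity_rootE => /eqP h; exists n => //.
by rewrite unity_rootE exprVn h invr1.
Qed.

Lemma unityM y z : is_unity_root y -> is_unity_root z -> is_unity_root (y * z).
Proof.
move=> [n n0]; rewrite unity_rootE => /eqP hy [m m0]; rewrite unity_rootE => /eqP hz.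
exists (n * m)%N; first by rewrite muln_gt0 n0.
by rewrite unity_rootE exprMn exprM hy mulnC exprM hz !expr1n mulr1.
Qed.

Lemma unity_prod (I : Type) (s : seq I) (F : I -> C) :
  (forall i, is_unity_root (F i)) -> is_unity_root (\prod_(i <- s) F i).
Proof.
move=> h; elim/big_ind: _ => //; last exact: unityM.
by exists 1%N => //; rewrite unity_rootE expr1n.
Qed.

Lemma regularV p y : regular (p, y) -> regular (p, y^-1).
Proof.
move=> [p0 hy py1]; split=> //; first exact: unityV.
by case=> p1 y1; apply: py1; rewrite p1 -(invrK y) y1 invr1.
Qed.

Lemma regularD p e y : regular (p, y) -> regular ((p + e)%N, y).
Proof.
move=> [p0 hy py1]; split=> //=; first by rewrite addn_gt0 p0.
by case=> p1 y1; apply: py1; rewrite y1; congr (_, _); move: p0; rewrite /=; lia.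
Qed.

Lemma half_real : (2^-1 : C) = (2^-1 : R)%:C%C.
Proof. by rewrite fmorphV rmorph_nat. Qed.

Lemma zetan_wsum n p y : zetan n p y = y * wsum 1 p y (fun=> 1) n.
Proof.
rewrite /zetan big_add1 /= mulr_sumr; apply: eq_bigr => i _.
by rewrite /wt rmorph1 natr1 mulr1 mulrA -exprS.
Qed.

Lemma tn_wsum n p y : tn n p y = y * wsum 2^-1 p y (fun=> 1) n.
Proof.
rewrite /tn big_add1 /= mulr_sumr; apply: eq_bigr => i _.
rewrite /wt -half_real mulr1 mulrA -exprS -natr1; congr (_ / _ ^+ _).
by field.
Qed.

Lemma tame1Z c f B : tame1 B f -> exists B', tame1 B' (fun n => c * f n).
Proof. by move=> /tame_id/(tameZ c)[B' h]; exists B'; exact: (h 0%N). Qed.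

Lemma tame1_zetan u : regular u -> exists B, tame1 B (fun n => zetan n u.1 u.2).
Proof.
move=> [u0 hu u1]; have [||||B /(tame1Z u.2)[B' h]] := @tame1_wsum1 _ 1 u.1 u.2; rewrite -?surjective_pairing //.
  by lra.
by exists B'; rewrite (_ : (fun n => _) = (fun n => u.2 * wsum 1 u.1 u.2 (fun=> 1) n)) //; apply/funext => n; exact: zetan_wsum.
Qed.

Lemma tame1_tn u : regular u -> exists B, tame1 B (fun n => tn n u.1 u.2).
Proof.
move=> [u0 hu u1]; have [||||B /(tame1Z u.2)[B' h]] := @tame1_wsum1 _ 2^-1 u.1 u.2; rewrite -?surjective_pairing //.
by exists B'; rewrite (_ : (fun n => _) = (fun n => u.2 * wsum 2^-1 u.1 u.2 (fun=> 1) n)) //; apply/funext => n; exact: tn_wsum.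
Qed.

Lemma tame1_succ f B : tame1 B f -> exists B', tame1 B' (fun n => f n.+1).
Proof.
move=> /tame_shift[B' h]; exists B'; have := h 1%N.
by rewrite (_ : (fun n => f (n + 1)%N) = (fun n => f n.+1)) //; apply/funext => n; rewrite addn1.
Qed.

Lemma tame1_prod (I : Type) (s : seq I) (F : nat -> I -> C) :
  (forall i, exists B, tame1 B (F ^~ i)) -> exists B, tame1 B (fun n => \prod_(i <- s) F n i).
Proof.
move=> h; have [|B hB] := @tame_prod _ _ s (fun i _ n => F n i).
  by move=> i; have [B hB] := h i; exact: tame_id hB.
by exists B; exact: (hB 0%N).
Qed.

Lemma Rsum_tends k (p : 'I_k -> nat) q (ys : 'I_k -> C) y :
  regular (q, y) -> (forall j, regular (p j, ys j)) ->
  tends (wsum 2^-1 q y (fun i => \prod_(j < k) zetan i (p j) (ys j)))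
    (Rsum p q ys y).
Proof.
move=> [q0 hy qy] hp.
have [|B hB] := @tame1_prod _ (index_enum 'I_k) (fun i j => zetan i (p j) (ys j)).
  by move=> j; exact: tame1_zetan (hp j).
have [l hl] := wsum_tends (lexx 2^-1) hy q0 qy hB.
suff -> : Rsum p q ys y = l by exact: hl.
apply: tends_climn; apply: tends_ext (tends_shift 1 hl) => N.
rewrite addn1 /wsum; apply: eq_bigr => n _; rewrite /wt -half_real; ring.
Qed.

(** The weighted sum starts at index 0 and the S-sum at 1: the shift costs the factor y^-1 and turns
    t_n into t_(n+1). *)
Lemma Ssum_tends k (p : 'I_k -> nat) q (ys : 'I_k -> C) y :
  regular (q, y) -> (forall j, regular (p j, ys j)) ->
  tends (wsum 1 q y (fun i => \prod_(j < k) tn i.+1 (p j) (ys j)))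
    (y^-1 * Ssum p q ys y).
Proof.
move=> [q0 hy qy] hp; have y0 := unity_neq0 hy.
have [|B hB] := @tame1_prod _ (index_enum 'I_k) (fun i j => tn i.+1 (p j) (ys j)).
  by move=> j; have [B /tame1_succ] := tame1_tn (hp j).
have [|l hl] := @wsum_tends _ 1 _ _ _ _ _ hy q0 qy hB; first by lra.
suff -> : Ssum p q ys y = y * l by rewrite mulrA mulVf ?mul1r.
apply: tends_climn; apply: tends_ext (tendsZ y hl) => N.
rewrite /wsum big_add1 /= mulr_sumr; apply: eq_bigr => n _.
by rewrite /wt rmorph1 natr1 exprS; ring.
Qed.

Definition Li q y : C := @Ssum R 0 (fun=> 0%N) q (fun=> 0) y.
Definition ti q y : C := @Rsum R 0 (fun=> 0%N) q (fun=> 0) y.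

Lemma admissible_regular k (p : 'I_k -> nat) q (ys : 'I_k -> C) y :
  regular (q, y) -> (forall j, regular (p j, ys j)) -> admissible p q ys y.
Proof.
by move=> [q0 hy qy] h; split=> // j; have [] := h j.
Qed.

Lemma Li_euler q y : regular (q, y) -> euler_sum 0 (Li q y).
Proof. by move=> h; apply: EulerS; apply: admissible_regular => // -[]. Qed.

Lemma ti_euler q y : regular (q, y) -> euler_sum 0 (ti q y).
Proof. by move=> h; apply: EulerR; apply: admissible_regular => // -[]. Qed.

Lemma Li_tends q y : regular (q, y) -> tends (fun n => zetan n q y) (Li q y).
Proof.
move=> h; have [_ hy _] := h; have y0 := unity_neq0 hy.
have hh : forall j : 'I_0, regular ((fun=> 0%N) j, (fun=> 0) j) by case.
have := tendsZ y (Ssum_tends h hh); rewrite mulrA divff // mul1r.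
by apply: tends_ext => n; rewrite zetan_wsum; under [in LHS]eq_fun do rewrite big_ord0.
Qed.

Lemma ti_tends q y : regular (q, y) -> tends (wsum 2^-1 q y (fun=> 1)) (ti q y).
Proof.
move=> h; have hh : forall j : 'I_0, regular ((fun=> 0%N) j, (fun=> 0) j) by case.
have := Rsum_tends h hh.
by apply: tends_ext => n; under [in LHS]eq_fun do rewrite big_ord0.
Qed.

Lemma tn_tends q y : regular (q, y) -> tends (fun n => tn n q y) (y * ti q y).
Proof.
by move=> /ti_tends/(tendsZ y); apply: tends_ext => n; rewrite tn_wsum.
Qed.

(** * The coefficient ring and the combinations of lower order *)

Section Combination.
Variables (G : set C) (r : nat).
Local Notation Q := (Qalg (G `|` @euler_sum R 0)).
Local Notation LC := (lower_order_combination G r).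

Lemma Q_int (a : int) : Q a%:~R.
Proof. by rewrite -(ratr_int C a); exact: Qalg_rat. Qed.

Lemma Q0 : Q 0. Proof. exact: (Q_int 0). Qed.
Lemma Q1 : Q 1. Proof. exact: (Q_int 1). Qed.

Lemma QN z : Q z -> Q (- z).
Proof. by move=> h; rewrite -mulN1r; apply: Qalg_mul h; exact: (Q_int (-1)). Qed.

Lemma Q_prod (I : Type) (s : seq I) (F : I -> C) :
  (forall i, Q (F i)) -> Q (\prod_(i <- s) F i).
Proof. by move=> h; elim/big_ind: _ => //; [exact: Q1|exact: Qalg_mul]. Qed.

Lemma QX z n : Q z -> Q (z ^+ n).
Proof. by move=> h; elim: n => [|n IH]; [exact: Q1|rewrite exprS; exact: Qalg_mul]. Qed.

(** The inverse of a root of unity is a power of it with natural exponent, so a subalgebra already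
    contains it. *)
Lemma QV_unity z : is_unity_root z -> Q z -> Q z^-1.
Proof.
move=> hz; have z0 := unity_neq0 hz; case: hz => n n0; rewrite unity_rootE => /eqP h hz.
suff -> : z^-1 = z ^+ n.-1 by exact: QX.
by apply: (mulfI z0); rewrite divff // -exprS prednK.
Qed.

Lemma Q_euler z : euler_sum 0 z -> Q z.
Proof. by move=> h; apply: Qalg_gen; right. Qed.

Lemma LC0 : LC 0.
Proof.
by exists 0%N, (fun=> 0), (fun=> 0); split=> [[]|[]|]; rewrite ?big_ord0.
Qed.

Lemma LC_euler k c z : (k < r)%N -> Q c -> euler_sum k z -> LC (c * z).
Proof.
move=> kr hc hz; exists 1%N, (fun=> c), (fun=> z); split=> // [i|].
  by exists k.
by rewrite big_ord1.
Qed.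

Lemma LCD z z' : LC z -> LC z' -> LC (z + z').
Proof.
move=> [m [c [s [hc hs ->]]]] [m' [c' [s' [hc' hs' ->]]]].
exists (m + m')%N, (fun i => match fintype.split i with inl j => c j | inr j => c' j end),
  (fun i => match fintype.split i with inl j => s j | inr j => s' j end); split.
- by move=> i; case: (fintype.split i).
- by move=> i; case: (fintype.split i).
rewrite big_split_ord /=; congr (_ + _); apply: eq_bigr => i _.
  by rewrite (unsplitK (inl i)).
by rewrite (unsplitK (inr i)).
Qed.

Lemma LCZ c z : Q c -> LC z -> LC (c * z).
Proof.
move=> hc [m [c' [s [hc' hs ->]]]]; exists m, (fun i => c * c' i), s.
split=> // [i|]; first exact: Qalg_mul.
by rewrite mulr_sumr; apply: eq_bigr => i _; rewrite mulrA.
Qed.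

Lemma LCN z : LC z -> LC (- z).
Proof. by move=> h; rewrite -mulN1r; apply: LCZ h; apply: QN; exact: Q1. Qed.

Lemma LC_sum (I : Type) (s : seq I) (F : I -> C) :
  (forall i, LC (F i)) -> LC (\sum_(i <- s) F i).
Proof. by move=> h; elim/big_ind: _ => //; [exact: LC0|exact: LCD]. Qed.

(** * Polynomials of bounded degree in zeta- or t-sums *)

Section NormalForm.
Variable b : nat -> nat * C -> C.

(** The bound [k] on the number of factors is the order of the Euler sums that arise on summing
    against a weight. The base [b n u] will be zeta_n or t_(n+1). *)
Inductive nf (k : nat) : (nat -> C) -> Prop :=
| nf_zero : nf k (fun=> 0)
| nf_term c (s : seq (nat * C)) f of Q c & (size s <= k)%N &
    {in s, forall u, regular u} & nf k f :
    nf k (fun n => c * \prod_(u <- s) b n u + f n).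

Lemma nf_ext k f g : f =1 g -> nf k f -> nf k g.
Proof. by move=> /funext ->. Qed.

Lemma nf_mono k k' f : (k <= k')%N -> nf k f -> nf k' f.
Proof.
move=> kk'; elim=> [|c s g hc hs sr _ IH]; first exact: nf_zero.
by apply: nf_term => //; exact: leq_trans hs kk'.
Qed.

Lemma nf_cst k c : Q c -> nf k (fun=> c).
Proof.
move=> hc; apply: (@nf_ext k (fun n => c * \prod_(u <- [::]) b n u + 0)).
  by move=> n; rewrite big_nil mulr1 addr0.
by apply: nf_term => //; exact: nf_zero.
Qed.

Lemma nf_base k u : (0 < k)%N -> regular u -> nf k (fun n => b n u).
Proof.
move=> k0 hu; apply: (@nf_ext k (fun n => 1 * \prod_(v <- [:: u]) b n v + 0)).
  by move=> n; rewrite big_seq1 mul1r addr0.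
apply: nf_term => //; [exact: Q1| |exact: nf_zero].
by move=> v; rewrite inE => /eqP ->.
Qed.

Lemma nfD k f g : nf k f -> nf k g -> nf k (fun n => f n + g n).
Proof.
move=> hf hg; elim: hf => [|c s f' hc hs sr _ IH].
  by apply: nf_ext hg => n; rewrite add0r.
by apply: nf_ext (nf_term hc hs sr IH) => n; rewrite addrA.
Qed.

Lemma nfM k k' f g : nf k f -> nf k' g -> nf (k + k') (fun n => f n * g n).
Proof.
move=> hf hg; elim: hf => [|c s f' hc hs sr _ IH].
  by apply: nf_ext (nf_zero _) => n; rewrite mul0r.
have : nf (k + k') (fun n => (c * \prod_(u <- s) b n u) * g n).
  elim: hg => [|c' s' g' hc' hs' sr' _ IHg].
    by apply: nf_ext (nf_zero _) => n; rewrite mulr0.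
  have ss : (size (s ++ s') <= k + k')%N by rewrite size_cat leq_add.
  have rr : {in s ++ s', forall u, regular u}.
    by move=> u; rewrite mem_cat => /orP[/sr|/sr'].
  apply: nf_ext (nf_term (Qalg_mul hc hc') ss rr IHg) => n.
  by rewrite big_cat /=; ring.
by move=> /nfD/(_ IH); apply: nf_ext => n; rewrite mulrDl.
Qed.

Lemma nfZ k c f : Q c -> nf k f -> nf k (fun n => c * f n).
Proof. by move=> hc hf; have := nfM (nf_cst 0 hc) hf. Qed.

Lemma nf_sum (I : Type) (s : seq I) k (F : I -> nat -> C) :
  (forall i, nf k (F i)) -> nf k (fun n => \sum_(i <- s) F i n).
Proof.
move=> h; elim: s => [|i s IH].
  by apply: nf_ext (nf_zero _) => n; rewrite big_nil.
by apply: nf_ext (nfD (h i) IH) => n; rewrite big_cons.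
Qed.

(** The constant [c] in the hypothesis makes room for the factor y^-1 in the limit for S-sums; for
    R-sums it is 1. *)
Lemma nf_tends (d : R) q y k f :
  (forall s : seq (nat * C), {in s, forall u, regular u} -> exists c z,
    [/\ Q c, euler_sum (size s) z &
      tends (wsum d q y (fun n => \prod_(u <- s) b n u)) (c * z)]) ->
  (k < r)%N -> nf k f -> exists2 l, LC l & tends (wsum d q y f) l.
Proof.
move=> hlim kr; elim=> [|c s g hc hs sr _ [l hl gl]].
  exists 0; first exact: LC0.
  by apply: tends_ext (tends_cst 0) => n; rewrite /wsum big1 // => i _; rewrite mulr0.
have [c' [z [hc' hz sz]]] := hlim _ sr.
exists (c * (c' * z) + l).
  by apply: LCD hl; apply: LCZ hc _; apply: LC_euler hz => //; exact: leq_ltn_trans hs kr.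
apply: tends_ext (tendsD (tendsZ c sz) gl) => n.
by rewrite /wsum mulr_sumr -big_split /=; apply: eq_bigr => i _; ring.
Qed.

(* Every other monomial of the expanded product misses some factor [b]. *)
Lemma nf_prod_top (I : eqType) (s : seq I) (t a : I -> C) (v : I -> nat * C) :
  (forall i, Q (t i)) -> (forall i, Q (a i)) -> (forall i, regular (v i)) ->
  (0 < size s)%N ->
  nf (size s).-1 (fun n => \prod_(i <- s) (t i + a i * b n (v i))
                   - \prod_(i <- s) (a i * b n (v i))).
Proof.
move=> ht ha hv; elim: s => // i [|j s] IH _.
  apply: nf_ext (nf_cst 0 (ht i)) => n; rewrite !big_seq1; ring.
have top k (s' : seq I) : (size s' <= k)%N -> nf k (fun n => \prod_(i <- s') (a i * b n (v i))).
  move=> sk; apply: nf_mono sk _; elim: s' => [|i' s' IH'].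
    by apply: nf_ext (nf_cst _ Q1) => n; rewrite big_nil.
  rewrite /= -add1n; apply: nf_ext (nfM (nfZ (ha i') (@nf_base 1 _ isT (hv i'))) IH') => n.
  by rewrite big_cons.
have h1 : nf 1 (fun n => t i + a i * b n (v i)).
  by apply: nfD; [exact: nf_cst|exact: nfZ (nf_base _ _)].
have h2 := nfZ (ht i) (top _ _ (leqnn (size (j :: s)))).
rewrite /= -add1n; apply: nf_ext (nfD (nfM h1 (IH isT)) h2) => n.
rewrite !(big_cons _ _ i); ring.
Qed.

End NormalForm.

Lemma nf_zetan_tends q y k f : regular (q, y) -> (k < r)%N ->
  nf (fun n u => zetan n u.1 u.2) k f ->
  exists2 l, LC l & tends (wsum 2^-1 q y f) l.
Proof.
move=> hq; apply: nf_tends => s sr.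
pose v (j : 'I_(size s)) := tnth (in_tuple s) j.
have hv j : regular ((v j).1, (v j).2).
  by rewrite -surjective_pairing; apply: sr; exact: mem_tnth.
exists 1, (Rsum (fun j => (v j).1) q (fun j => (v j).2) y); split.
- exact: Q1.
- by apply: EulerR; exact: admissible_regular.
rewrite mul1r; apply: tends_ext (Rsum_tends hq hv) => N.
by apply: eq_bigr => n _; rewrite [in RHS]big_tnth.
Qed.

Lemma nf_tn_tends q y k f : regular (q, y) -> Q y -> (k < r)%N ->
  nf (fun n u => tn n.+1 u.1 u.2) k f ->
  exists2 l, LC l & tends (wsum 1 q y f) l.
Proof.
move=> hq Qy; have [_ hy _] := hq; apply: nf_tends => s sr.
pose v (j : 'I_(size s)) := tnth (in_tuple s) j.
have hv j : regular ((v j).1, (v j).2).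
  by rewrite -surjective_pairing; apply: sr; exact: mem_tnth.
exists y^-1, (Ssum (fun j => (v j).1) q (fun j => (v j).2) y); split.
- exact: QV_unity.
- by apply: EulerS; exact: admissible_regular.
apply: tends_ext (Ssum_tends hq hv) => N.
by apply: eq_bigr => n _; rewrite [in RHS]big_tnth.
Qed.

End Combination.
End EulerSums.

(** * The kernel and its local expansions *)

Section Kernel.
Variable R : realType.
Local Notation C := R[i].
Implicit Types (y w c : C) (K M N p e : nat).

Definition cm (m : nat) : C := m%:R + 2^-1.

Lemma cmS m : cm m.+1 = cm m + 1.
Proof. by rewrite /cm -natr1 addrAC. Qed.

Lemma cm_neq_nat m n : cm m != n%:R.
Proof.
apply/eqP => h; have : (2 * m + 1)%:R = (2 * n)%:R :> C.
  by rewrite natrD !natrM -h /cm mulrDr divff.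
by move/eqP; rewrite eqr_nat; lia.
Qed.

Lemma cm_neq0 m : cm m != 0.
Proof. exact: (cm_neq_nat m 0). Qed.

Lemma natD_cm_neq0 n m : n%:R + cm m != 0.
Proof. by rewrite /cm addrA -natrD; exact: cm_neq0. Qed.

Lemma natB_cm_neq0 n m : - n%:R + cm m != 0.
Proof. by rewrite addrC subr_eq0 cm_neq_nat. Qed.

Definition poles N M : seq C :=
  0 :: [seq n%:R | n <- index_iota 1 N.+1] ++
       [seq - n%:R | n <- index_iota 1 N.+1] ++
       [seq - cm m | m <- index_iota 0 M.+1].

Lemma poles_uniq N M : uniq (poles N M).
Proof.
have inj_nat : injective (fun n => n%:R : C) by move=> a b /eqP; rewrite eqr_nat => /eqP.
rewrite /poles cons_uniq mem_cat negb_or mem_cat negb_or !cat_uniq.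
apply/and4P; split; [apply/and3P; split| | |apply/and3P; split].
- by apply/negP => /mapP[n]; rewrite mem_index_iota => + /esym/eqP; rewrite pnatr_eq0; lia.
- by apply/negP => /mapP[n]; rewrite mem_index_iota => + /esym/eqP; rewrite oppr_eq0 pnatr_eq0; lia.
- by apply/negP => /mapP; case=> m _ /eqP; rewrite eq_sym oppr_eq0 (negPf (cm_neq0 m)).
- by rewrite map_inj_uniq ?iota_uniq.
- rewrite has_cat negb_or; apply/andP; split; apply/hasPn => c /mapP[a ha ->]; apply/negP => /mapP[b hb].
    move/eqP; rewrite eq_sym -subr_eq0 opprK -natrD pnatr_eq0.
    by move: ha hb; rewrite !mem_index_iota; lia.
  by move/eqP; rewrite eq_sym -subr_eq0 opprK (negPf (natD_cm_neq0 _ _)).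
- by rewrite map_inj_uniq ?iota_uniq // => a b /oppr_inj/inj_nat.
- apply/hasPn => c /mapP[a _ ->]; apply/negP => /mapP[b _ /oppr_inj/eqP].
  by rewrite (negPf (cm_neq_nat _ _)).
- by rewrite map_inj_uniq ?iota_uniq // => a b /oppr_inj/addIr/inj_nat.
Qed.

(** A twisted, symmetrically truncated cotangent kernel: for w = 1 it approximates pi cot(pi s). *)
Definition Phi w N : nat * seq (C * C) :=
  (1%N, (1, 0) :: [seq (w ^+ n, n%:R) | n <- index_iota 1 N.+1] ++
                  [seq (w ^- n, - n%:R) | n <- index_iota 1 N.+1]).

Definition Asum y p M : nat * seq (C * C) :=
  (p, [seq (y ^+ m, - cm m) | m <- index_iota 0 M.+1]).

Definition pole0 q : nat * seq (C * C) := (q, [:: (1, 0)]).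

Lemma loc_sum_Phi K w N c : loc_sum K c (Phi w N) = loc K c 0 +
  \sum_(1 <= n < N.+1) (w ^+ n *: loc K c n%:R + w ^- n *: loc K c (- n%:R)).
Proof.
rewrite /loc_sum /= big_cons big_cat /= !big_map scale1r expr1 big_split /=.
by congr (_ + (_ + _)); apply: eq_bigr => n _; rewrite expr1.
Qed.

Lemma loc_sum_Asum K y p M c : loc_sum K c (Asum y p M) =
  \sum_(0 <= m < M.+1) y ^+ m *: loc K c (- cm m) ^+ p.
Proof. exact: big_map. Qed.

Lemma loc_sum_pole0 K q c : loc_sum K c (pole0 q) = loc K c 0 ^+ q.
Proof. by rewrite /loc_sum /= big_seq1 scale1r. Qed.

Definition Areg K y p M c : {poly C} :=
  \sum_(0 <= m < M.+1) y ^+ m *: geo K (c + cm m) ^+ p.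

Lemma loc_sum_AsumE K y p M c : (forall m, c + cm m != 0) ->
  loc_sum K c (Asum y p M) = 'X^p * Areg K y p M c.
Proof.
move=> h; rewrite loc_sum_Asum mulr_sumr; apply: eq_bigr => m _.
by rewrite /loc -subr_eq0 opprK (negPf (h m)) exprMn scalerAr.
Qed.

(** For [e < K] this is the coefficient of X^e in (1 + X)^-p, up to sign a binomial coefficient. *)
Definition kap K p e : C := (geo K 1 ^+ p)`_e.

Lemma coef_geo K c p e : (geo K c ^+ p)`_e = c ^- (p + e) * kap K p e.
Proof. exact: coef_geoX. Qed.

Lemma kap0 K p : (0 < K)%N -> kap K p 0 = 1.
Proof.
move=> K0; elim: p => [|p IH]; first by rewrite /kap expr0 coef1.
by rewrite /kap exprS coef0M -/(kap K p 0) IH /geo coef_poly K0 expr1n invr1 !mulr1.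
Qed.

Lemma coef0_geo K c p : (0 < K)%N -> (geo K c ^+ p)`_0 = c ^- p.
Proof. by move=> K0; rewrite coef_geo kap0 // addn0 mulr1. Qed.

Lemma coef_Areg0 K y p M e :
  (Areg K y p M 0)`_e = kap K p e * wsum 2^-1 (p + e) y (fun=> 1) M.+1.
Proof.
rewrite /Areg coef_sum mulr_sumr; apply: eq_bigr => m _.
by rewrite coefZ coef_geo add0r /wt -half_real /cm mulr1; ring.
Qed.

Lemma coef0_Phi_pos K w N n : (0 < n <= N)%N -> (loc_sum K n%:R (Phi w N))`_0 = w ^+ n.
Proof.
move=> /andP[n0 nN]; rewrite loc_sum_Phi coefD coef_sum loc_coef0 pnatr_eq0 (gtn_eqF n0) add0r.
rewrite (bigD1_seq n) ?iota_uniq ?mem_index_iota ?n0 ?ltnS //= big1_seq ?addr0.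
  rewrite coefD !coefZ !loc_coef0 eqxx -subr_eq0 opprK -natrD pnatr_eq0 addn_eq0 (gtn_eqF n0) /=.
  by rewrite mulr1 mulr0 addr0.
move=> i /andP[/negPf ni _]; rewrite coefD !coefZ !loc_coef0 eqr_nat [n == i]eq_sym ni.
rewrite -subr_eq0 opprK -natrD pnatr_eq0 addn_eq0 (gtn_eqF n0) /=.
by rewrite !mulr0 addr0.
Qed.

Lemma coef0_Phi_neg K w N n : (0 < n <= N)%N -> (loc_sum K (- n%:R) (Phi w N))`_0 = w ^- n.
Proof.
move=> /andP[n0 nN]; rewrite loc_sum_Phi coefD coef_sum loc_coef0 oppr_eq0 pnatr_eq0 (gtn_eqF n0) add0r.
rewrite (bigD1_seq n) ?iota_uniq ?mem_index_iota ?n0 ?ltnS //= big1_seq ?addr0.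
  rewrite coefD !coefZ !loc_coef0 eqxx eq_sym -subr_eq0 opprK -natrD pnatr_eq0 addn_eq0 (gtn_eqF n0) /=.
  by rewrite mulr1 mulr0 add0r.
move=> i /andP[/negPf ni _]; rewrite coefD !coefZ !loc_coef0 eqr_opp eqr_nat [n == i]eq_sym ni.
rewrite eq_sym -subr_eq0 opprK -natrD pnatr_eq0 addn_eq0 (gtn_eqF n0) andbF /=.
by rewrite !mulr0 addr0.
Qed.

Lemma tnS n p y : tn n.+1 p y = tn n p y + y ^+ n.+1 / cm n ^+ p.
Proof.
rewrite /tn big_nat_recr //=; congr (_ + _ / _ ^+ _).
by rewrite /cm -natr1; field.
Qed.

(** Since n + m + 1/2 = (n + m + 1) - 1/2, a truncated factor evaluated at s = n is a stretch of the
    t-sum beyond n. *)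
Lemma tn_diff_pos y p n k :
  y ^+ n.+1 * (\sum_(0 <= m < k) y ^+ m / (n%:R + cm m) ^+ p) =
  tn (n + k) p y - tn n p y.
Proof.
elim: k => [|k IH]; first by rewrite big_geq // mulr0 addn0 subrr.
rewrite big_nat_recr //= mulrDr IH addnS tnS addrAC; congr (_ + _).
by rewrite mulrA -exprD addSn /cm addrA -natrD.
Qed.

(* [tn] extended to negative indices is [(-1) ^+ p.+1 * y * tn n p y^-1];
   one of the two truncated subtractions is always zero. *)
Lemma tn_diff_neg y p l k : y != 0 ->
  y * (\sum_(0 <= m < k) y ^+ m / (- l%:R + cm m) ^+ p) =
  y ^+ l * (tn (k - l) p y + (-1) ^+ p.+1 * y * tn (l - k) p y^-1
            - (-1) ^+ p.+1 * y * tn l p y^-1).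
Proof.
move=> y0; elim: k => [|k IH].
  rewrite big_geq // sub0n subn0 {1}/tn big_geq // add0r subrr !mulr0 //.
(* The new term lengthens the t-sum of positive index once l <= k; before that its denominator is
   negative and it shortens the reflected sum. *)
rewrite big_nat_recr //= mulrDr IH; have [lk|kl] := leqP l k.
  rewrite subSn // tnS (_ : l - k.+1 = l - k)%N; last by lia.
  have -> : - l%:R + cm k = cm (k - l) by rewrite /cm natrB //; ring.
  have -> : y ^+ k = y ^+ l * y ^+ (k - l) by rewrite -exprD subnKC.
  rewrite (exprS y (k - l)); move: (tn (k - l) p y) (tn (l - k) _ _) (tn l _ _) (_ ^- p) => a b c v; ring.
rewrite (_ : k.+1 - l = k - l)%N; last by lia.
rewrite (_ : l - k = (l - k.+1).+1)%N; last by lia.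
rewrite tnS; set i := (l - k.+1)%N.
have -> : l = (k + i.+1)%N by rewrite /i; lia.
have -> : - (k + i.+1)%:R + cm k = - cm i.
  by rewrite /cm natrD -natr1; field.
rewrite (exprNn (cm i)) exprD exprVn invfM invr_sign (exprS (-1)).
have yi : y ^+ i.+1 != 0 by rewrite expf_neq0.
have ci : cm i ^+ p != 0 by rewrite expf_neq0 ?cm_neq0.
move: (tn _ _ y) (tn i _ _) (tn (k + i.+1) _ _) (y ^+ k) ((-1) ^+ p) yi ci => a b c u s.
move: (y ^+ i.+1) (cm i ^+ p) => Y v Y0 v0.
by field; rewrite Y0 v0.
Qed.
End Kernel.

(** * The residue identity *)

Section ResidueIdentity.
Variable R : realType.
Local Notation C := R[i].
Implicit Types (y w c : C) (K M N p e : nat).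

(** The regular part of a factor at its own pole -(m + 1/2), divided by y^m. Poles of index l > m
    give zeta_(M-m)(y), those with l < m give zeta_m(y^-1) with a sign. The length loses no
    coefficient because [kap] vanishes beyond it. *)
Definition gpoly K y p M m : {poly C} :=
  \poly_(e < (K * p).+1) (kap R K p e *
     (zetan (M - m) (p + e) y + (-1) ^+ (p + e) * zetan m (p + e) y^-1)).

Lemma kap_eq0 K p e : (K * p < e)%N -> kap R K p e = 0.
Proof.
move=> h; rewrite /kap nth_default //.
apply: leq_trans (size_exp_leq _ _) _.
have : (size (geo K (1 : C)) <= K)%N by exact: size_poly.
by move: h; case: (size _) => [|n] /=; nia.
Qed.

Lemma coef_gpoly K y p M m e : (gpoly K y p M m)`_e = kap R K p e *
     (zetan (M - m) (p + e) y + (-1) ^+ (p + e) * zetan m (p + e) y^-1).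
Proof.
rewrite coef_poly ltnS; case: leqP => // h.
by rewrite kap_eq0 ?mul0r.
Qed.

Lemma sum_below y m s : y != 0 ->
  \sum_(0 <= l < m) y ^+ l * (l%:R - m%:R) ^- s = y ^+ m * ((-1) ^+ s * zetan m s y^-1).
Proof.
move=> y0; rewrite big_nat_rev /= /zetan big_add1 /= !mulr_sumr.
apply: eq_big_nat => i /andP[_ im]; rewrite add0n.
have -> : y ^+ m = y ^+ (m - i.+1) * y ^+ i.+1 by rewrite -exprD subnK.
rewrite natrB // addrAC subrr add0r (exprNn i.+1%:R) invfM invr_sign exprVn.
rewrite mulrA -[y ^+ _ * y ^+ _ * _]mulrA [y ^+ i.+1 * _]mulrCA !mulrA.
by rewrite mulfK ?expf_neq0.
Qed.

Lemma sum_above y M m s : (m <= M)%N ->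
  \sum_(m.+1 <= l < M.+1) y ^+ l * (l%:R - m%:R) ^- s = y ^+ m * zetan (M - m) s y.
Proof.
move=> mM; rewrite -{1}(add0n m.+1) big_addn subSS /zetan big_add1 /= mulr_sumr.
apply: eq_bigr => i _; rewrite mulrA -exprD addnS -addSn addnC.
by rewrite natrD addrAC subrr add0r.
Qed.

Lemma loc_sum_Asum_pole K y p M m : y != 0 -> (m <= M)%N ->
  loc_sum K (- cm R m) (Asum y p M) = y ^+ m *: (1 + 'X^p * gpoly K y p M m).
Proof.
move=> y0 mM; rewrite loc_sum_Asum.
have locE l : l != m -> y ^+ l *: loc K (- cm R m) (- cm R l) ^+ p =
    'X^p * (y ^+ l *: geo K (l%:R - m%:R) ^+ p).
  move=> lm; rewrite /loc eqr_opp (inj_eq (addIr _)) eqr_nat eq_sym (negPf lm).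
  rewrite exprMn -scalerAr; congr (_ *: (_ * geo _ _ ^+ _)).
  by rewrite /cm; ring.
rewrite (@big_cat_nat _ _ _ m) //=; last exact: leqW.
rewrite [X in _ + X]big_ltn ?ltnS // {2}/loc eqxx expr1n.
rewrite (eq_big_nat _ _ (F2 := fun l => 'X^p * (y ^+ l *: geo K (l%:R - m%:R) ^+ p))); last first.
  by move=> l /andP[_ lm]; rewrite locE // ltn_eqF.
rewrite [X in _ + (_ + X)](eq_big_nat _ _ (F2 := fun l => 'X^p * (y ^+ l *: geo K (l%:R - m%:R) ^+ p))); last first.
  by move=> l /andP[lm _]; rewrite locE // gtn_eqF.
rewrite -!mulr_sumr addrCA scalerDr -mulrDr scalerAr; congr (_ + _ * _).
apply/polyP => e; rewrite coefD coefZ coef_gpoly !coef_sum.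
under eq_bigr do rewrite coefZ coef_geo mulrA.
under [X in _ + X]eq_bigr do rewrite coefZ coef_geo mulrA.
rewrite -!mulr_suml sum_below // sum_above //; ring.
Qed.

Section Identity.
Variables (r : nat) (p : 'I_r -> nat) (q : nat) (xs : 'I_r -> C) (w : C).
Hypothesis q0 : (0 < q)%N.
Hypothesis xs0 : forall j, xs j != 0.

Let P := (\sum_(j < r) p j)%N.
(** The total degree of the denominators in each product of simple fractions; residues are therefore
    read off at degree q + P. *)
Let K := (1 + (q + P))%N.

Definition Aval y p M c : C := \sum_(0 <= m < M.+1) y ^+ m / (c + cm R m) ^+ p.

Lemma coef0_Areg y e M c : (Areg K y e M c)`_0 = Aval y e M c.
Proof.
rewrite /Areg coef_sum; apply: eq_bigr => m _.
by rewrite coefZ coef0_geo.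
Qed.

(** Here s^-q is regular, so its local factor carries X^q; after cancelling it the residue sits in
    degree [P]. *)
Definition half_residue N M m : C :=
  (\prod_(j < r) xs j) ^+ m * (loc_sum K (- cm R m) (Phi w N) *
   (geo K (- cm R m) ^+ q * \prod_(j < r) (1 + 'X^(p j) * gpoly K (xs j) (p j) M m)))`_P.

(** At 0 the r factors are regular and carry X^P in all, which leaves degree [q]. *)
Definition zero_residue N M : C :=
  (loc_sum K 0 (Phi w N) * \prod_(j < r) Areg K (xs j) (p j) M 0)`_q.

Let fs N M := [:: Phi w N, pole0 R q & [seq Asum (xs j) (p j) M | j <- index_enum 'I_r]].

Let prod_fs N M c : \prod_(f <- fs N M) loc_sum K c f =
  loc_sum K c (Phi w N) * (loc K c 0 ^+ q * \prod_(j < r) loc_sum K c (Asum (xs j) (p j) M)).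
Proof. by rewrite !big_cons big_map loc_sum_pole0. Qed.

Let deg_fs N M : (\sum_(f <- fs N M) f.1)%N = K.
Proof. by rewrite !big_cons big_map. Qed.

Let prodXn (F : 'I_r -> {poly C}) :
  \prod_(j < r) ('X^(p j) * F j) = 'X^P * \prod_(j < r) F j.
Proof. by rewrite big_split /= prodrXr. Qed.

(** Only the kernel can have a pole at [c], a simple one. All other factors together carry X^(q+P),
    hence just constant terms enter. *)
Lemma residue_regular N M c : c != 0 -> (forall m, c + cm R m != 0) ->
  (\prod_(f <- fs N M) loc_sum K c f)`_(q + P) =
  (loc_sum K c (Phi w N))`_0 * (c ^- q * \prod_(j < r) Aval (xs j) (p j) M c).
Proof.
move=> c0 hc; rewrite prod_fs.
under eq_bigr do rewrite loc_sum_AsumE //.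
rewrite prodXn /loc (negPf c0) subr0 exprMn.
have -> (u v s : {poly C}) : s * ('X^q * u * ('X^P * v)) = 'X^(q + P) * (s * (u * v)).
  by rewrite exprD; ring.
rewrite coefXnM ltnn subnn !coef0M coef0_geo // coef0_prod; congr (_ * (_ * _)).
by apply: eq_bigr => j _; exact: coef0_Areg.
Qed.

Lemma residue_identity N M :
  \sum_(1 <= n < N.+1) w ^+ n * (n%:R ^- q * \prod_(j < r) Aval (xs j) (p j) M n%:R) +
  \sum_(1 <= n < N.+1) w ^- n * ((- n%:R) ^- q * \prod_(j < r) Aval (xs j) (p j) M (- n%:R)) +
  zero_residue N M + \sum_(0 <= m < M.+1) half_residue N M m = 0.
Proof.
have H : \sum_(c <- poles R N M) (\prod_(f <- fs N M) loc_sum K c f)`_(q + P) = 0.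
  have := @residue_sum0 C K (poles R N M) (fs N M) (poles_uniq R N M).
  rewrite deg_fs; apply; last by rewrite leqnn andbT /K; move: q0; lia.
  have h1 n : n \in index_iota 1 N.+1 -> n%:R \in poles R N M.
    by move=> hn; rewrite inE mem_cat map_f ?orbT.
  have h2 n : n \in index_iota 1 N.+1 -> - n%:R \in poles R N M.
    by move=> hn; rewrite inE mem_cat mem_cat (map_f (fun n => - n%:R) hn) ?orbT.
  have h3 m : m \in index_iota 0 M.+1 -> - cm R m \in poles R N M.
    by move=> hm; rewrite inE mem_cat mem_cat (map_f (fun m => - cm R m) hm) ?orbT.
  have h0 : 0 \in poles R N M by exact: mem_head.
  move=> f t; rewrite !inE => /orP[/eqP ->|/orP[/eqP ->|/mapP[j _ ->]]].
  + rewrite in_cons mem_cat => /orP[/eqP -> //|/orP[]/mapP[n hn ->]]; [exact: h1|exact: h2].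
  + by rewrite inE => /eqP ->.
  + by move=> /mapP[m hm ->]; exact: h3.
apply: etrans H; rewrite /poles [RHS]big_cons [in RHS]big_cat [in RHS]big_cat !big_map.
rewrite -!addrA [RHS]addrCA; congr (_ + _).
  apply: eq_big_nat => n /andP[n0 nN]; rewrite residue_regular ?coef0_Phi_pos ?n0 //.
    by rewrite pnatr_eq0 -lt0n.
  by move=> m; exact: natD_cm_neq0.
rewrite [RHS]addrCA; congr (_ + _).
  apply: eq_big_nat => n /andP[n0 nN]; rewrite residue_regular ?coef0_Phi_neg ?n0 //.
    by rewrite oppr_eq0 pnatr_eq0 -lt0n.
  by move=> m; exact: natB_cm_neq0.
congr (_ + _).
  rewrite prod_fs /zero_residue.
  have A0 m : 0 + cm R m != 0 by rewrite add0r cm_neq0.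
  under [in RHS]eq_bigr do rewrite (loc_sum_AsumE _ _ _ _ A0).
  rewrite prodXn /loc eqxx expr1n mul1r mulrCA coefXnM.
  by rewrite ltnNge leq_addl addnK.
apply: eq_big_nat => m /andP[_ mM]; rewrite prod_fs /half_residue.
under [in RHS]eq_bigr do rewrite loc_sum_Asum_pole //.
rewrite /loc oppr_eq0 (negPf (cm_neq0 R m)) subr0 exprMn.
have -> : \prod_(j < r) (xs j ^+ m *: (1 + 'X^(p j) * gpoly K (xs j) (p j) M m)) =
   (\prod_(j < r) xs j) ^+ m *: \prod_(j < r) (1 + 'X^(p j) * gpoly K (xs j) (p j) M m).
  by rewrite scaler_prod prodrXl.
have -> (u v t : {poly C}) : t * ('X^q * u * v) = 'X^q * (t * (u * v)) by ring.
by rewrite coefXnM ltnNge leq_addr addKn -!scalerAr coefZ.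
Qed.

End Identity.
End ResidueIdentity.

(** * Limits of the local expansions *)

Section Asymptotics.
Variable R : realType.
Local Notation C := R[i].
Variables (G : set C) (r : nat).
Local Notation Q := (Qalg (G `|` @euler_sum R 0)).
Local Notation LC := (lower_order_combination G r).
Implicit Types (y w c : C) (K M N p e b : nat).

Lemma Q_kap K p e : Q (kap R K p e).
Proof. by have [a] := coef_geoX_int C K p e; rewrite /kap => ->; exact: Q_int. Qed.

Lemma regular_or p y : (0 < p)%N -> is_unity_root y ->
  regular (p, y) \/ p = 1%N /\ y = 1.
Proof.
move=> p0 hy; have [[-> ->]|h] := pselect ((p, y) = (1%N, 1)); first by right.
by left.
Qed.

Lemma coef_loc K c d e : c != d -> (loc K c d)`_e.+1 = (c - d) ^- e.+1 * kap R K 1 e.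
Proof.
by move=> /negPf h; rewrite /loc h coefXM /= -{1}(expr1 (geo _ _)) coef_geo.
Qed.

Lemma wt_tends0 d q y : 0 < d -> (0 < q)%N -> is_unity_root y -> tends (wt d q y) 0.
Proof.
move=> d0 q0 hy e e0; have [k k0 hk] := natinv_lt 1 e0.
exists k => n kn; rewrite subr0 nm_wt //; last exact: ltW.
apply: le_lt_trans hk; rewrite mul1r.
have k1 : 1 <= k%:R :> R by rewrite ler1n.
have kn' : k%:R <= n%:R :> R by rewrite ler_nat.
rewrite lef_pV2 ?posrE ?exprn_gt0 ?ltr0n //; last by lra.
apply: (@le_trans _ _ (n%:R + d)); first by lra.
by rewrite -[leLHS]expr1 ler_weXn2l //; lra.
Qed.

(** The constant term 1 is the polar part of the kernel. The later coefficients combine zeta-sums at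
    w and w^-1; in degree 1 with w = 1 these diverge but cancel exactly for every N. *)
Lemma Phi0_tends K w e : is_unity_root w ->
  exists2 l, Q l & tends (fun N => (loc_sum K 0 (Phi w N))`_e) l.
Proof.
move=> hw; case: e => [|e].
  exists 1; first exact: Q1.
  apply: tends_ext (tends_cst 1) => N.
  rewrite loc_sum_Phi coefD loc_coef0 eqxx coef_sum big1_seq ?addr0 // => n.
  rewrite mem_index_iota => /andP[_ /andP[n0 _]].
  rewrite coefD !coefZ !loc_coef0 ![0 == _]eq_sym oppr_eq0 pnatr_eq0 (gtn_eqF n0).
  by rewrite !mulr0 addr0.
have E N : (loc_sum K 0 (Phi w N))`_e.+1 =
    kap R K 1 e * ((-1) ^+ e.+1 * zetan N e.+1 w + zetan N e.+1 w^-1).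
  rewrite loc_sum_Phi coefD coef_sum {1}/loc eqxx coef1 add0r.
  rewrite /zetan mulr_sumr -big_split mulr_sumr; apply: eq_big_nat => n /andP[n0 _].
  rewrite coefD !coefZ !coef_loc; last 2 first.
  - by rewrite eq_sym oppr_eq0 pnatr_eq0 -lt0n.
  - by rewrite eq_sym pnatr_eq0 -lt0n.
  rewrite !sub0r opprK (exprNn n%:R) invfM invr_sign exprVn.
  rewrite /=; move: (kap _ _ _ _) (n%:R ^- _) (w ^+ n) (w ^- n) ((-1) ^+ e.+1) => *; ring.
have [h|[e1 w1]] := regular_or (ltn0Sn e) hw.
  exists (kap R K 1 e * ((-1) ^+ e.+1 * Li e.+1 w + Li e.+1 w^-1)).
    apply: Qalg_mul (Q_kap _ _ _) _; apply: Qalg_add.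
      apply: Qalg_mul; first by apply: QX; apply: QN; exact: Q1.
      by apply: Q_euler; exact: Li_euler.
    by apply: Q_euler; apply: Li_euler; exact: regularV.
  apply: (@tends_ext _ (fun N => _)); first by move=> N; symmetry; exact: E.
  apply: tendsZ; apply: tendsD; first by apply: tendsZ; exact: Li_tends.
  by apply: Li_tends; exact: regularV.
exists 0; first exact: Q0.
apply: tends_ext (tends_cst 0) => N.
by rewrite E e1 w1 invr1 expr1 mulN1r addNr mulr0.
Qed.

(** A sum over |n| <= N with n and -n paired; up to a constant factor, the coefficient of the kernel
    in degree b at -(m + 1/2). *)
Definition Psi w N m b : C := cm R m ^- b +
  \sum_(1 <= n < N.+1) (w ^+ n * (n%:R + cm R m) ^- b + w ^- n * (- n%:R + cm R m) ^- b).

Lemma coef0_Phi_half K w N m : (loc_sum K (- cm R m) (Phi w N))`_0 = 0.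
Proof.
rewrite loc_sum_Phi coefD loc_coef0 oppr_eq0 (negPf (cm_neq0 _ _)) coef_sum big1 ?addr0 // => n _.
rewrite coefD !coefZ !loc_coef0 eqr_opp (negPf (cm_neq_nat _ _ _)).
by rewrite eq_sym -subr_eq0 opprK (negPf (natD_cm_neq0 _ _ _)) !mulr0 addr0.
Qed.

Lemma coef_Phi_half K w N m e : (loc_sum K (- cm R m) (Phi w N))`_e.+1 =
  kap R K 1 e * (-1) ^+ e.+1 * Psi w N m e.+1.
Proof.
rewrite loc_sum_Phi coefD coef_loc ?oppr_eq0 ?cm_neq0 // coef_sum /Psi mulrDr mulr_sumr.
rewrite subr0 (exprNn (cm R m)) invfM invr_sign; congr (_ + _); first by ring.
apply: eq_bigr => n _; rewrite coefD !coefZ !coef_loc; last 2 first.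
- by rewrite eqr_opp cm_neq_nat.
- by rewrite eq_sym -subr_eq0 opprK natD_cm_neq0.
have -> : - cm R m - n%:R = - (n%:R + cm R m) by ring.
have -> : - cm R m - - n%:R = - (- n%:R + cm R m) by ring.
rewrite (exprNn (n%:R + _)) (exprNn (- n%:R + _)) !invfM !invr_sign.
move: (kap _ _ _ _) ((_ + _) ^- _) ((n%:R + _) ^- _) (w ^+ n) (w ^- n) ((-1) ^+ e.+1) => *; ring.
Qed.

(** Raising m by one translates n by one, so after multiplication by w^m only the two ends of the
    range differ. *)
Lemma Psi_step w N m b : w != 0 -> w ^+ m.+1 * Psi w N m.+1 b - w ^+ m * Psi w N m b =
  w ^+ (N + m.+1) * cm R (N + m.+1) ^- b - w ^+ m * w ^- N * (- N%:R + cm R m) ^- b.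
Proof.
move=> w0; elim: N => [|N IH].
  by rewrite /Psi !big_geq // !addr0 add0n expr0 invr1 oppr0 add0r mulr1.
have PS k : Psi w N.+1 k b = Psi w N k b + (w ^+ N.+1 * cm R (N.+1 + k) ^- b +
    w ^- N.+1 * (- N.+1%:R + cm R k) ^- b).
  rewrite /Psi big_nat_recr //= addrA; congr (_ + (_ * _ ^- _ + _)).
  by rewrite /cm natrD addrA.
have -> : w ^+ m.+1 * Psi w N.+1 m.+1 b - w ^+ m * Psi w N.+1 m b =
    (w ^+ m.+1 * Psi w N m.+1 b - w ^+ m * Psi w N m b) +
    (w ^+ m.+1 * (Psi w N.+1 m.+1 b - Psi w N m.+1 b)
     - w ^+ m * (Psi w N.+1 m b - Psi w N m b)) by ring.
have PB k : Psi w N.+1 k b - Psi w N k b = w ^+ N.+1 * cm R (N.+1 + k) ^- b +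
    w ^- N.+1 * (- N.+1%:R + cm R k) ^- b by rewrite PS [LHS]addrC addKr.
rewrite IH !PB.
have -> : - N.+1%:R + cm R m.+1 = - N%:R + cm R m by rewrite cmS -natr1; ring.
have wN : w ^+ N != 0 by rewrite expf_neq0.
rewrite -addSnnS (exprD _ N.+1 m.+1) (exprD _ N.+1 m) !exprS.
move: ((- N.+1%:R + _) ^- b) ((- _ + _) ^- b) (cm R (N.+1 + m) ^- b) (cm R (N.+1 + m.+1) ^- b) => a1 a2 a3 a4.
move: (w ^+ N) (w ^+ m) wN => v u v0; field.
by rewrite v0 w0.
Qed.

(** The end terms in [Psi_step] vanish in the limit, so w^m Psi has a limit independent of m, found
    at m = 0 from two half-sums. If b = w = 1 these cancel up to one vanishing term, as the
    cotangent vanishes at half-integers. *)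
Lemma Psi_tends w b : is_unity_root w -> Q w -> (0 < b)%N ->
  exists2 B, Q B & forall m, tends (fun N => Psi w N m b) (w ^- m * B).
Proof.
move=> hw Qw b0; have w0 := unity_neq0 hw; have hwV := unityV hw.
have E0 N : Psi w N 0 b = wsum 2^-1 b w (fun=> 1) N.+1 +
    (-1) ^+ b * w^-1 * wsum 2^-1 b w^-1 (fun=> 1) N.
  rewrite /Psi big_split /= addrA /wsum; congr (_ + _).
    rewrite [in RHS]big_nat_recl // big_add1 /=; congr (_ + _).
      by rewrite /wt expr0 mul1r mulr1 -half_real.
    by apply: eq_bigr => n _; rewrite /wt -half_real mulr1 /cm add0r.
  rewrite big_add1 /= mulr_sumr; apply: eq_bigr => n _.
  rewrite /wt -half_real mulr1 exprS invfM exprVn.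
  have -> : - n.+1%:R + cm R 0 = - (n%:R + 2^-1) by rewrite /cm -natr1; field.
  rewrite (exprNn (_ + _)) invfM invr_sign.
  move: ((_ + _) ^- b) => *; ring.
suff [B QB hB] : exists2 B, Q B & tends (fun N => Psi w N 0 b) B.
  exists B => //; elim=> [|m IH]; first by rewrite expr0 invr1 mul1r.
  have wm : w ^+ m.+1 != 0 by rewrite expf_neq0.
  have E N : Psi w N m.+1 b = w ^- m.+1 * (w ^+ m * Psi w N m b +
     (wt 2^-1 b w (N + m.+1) - w ^+ m * w ^- N * (- N%:R + cm R m) ^- b)).
    rewrite /wt -half_real -Psi_step // addrC subrK mulrA mulVf ?mul1r //.
  apply: (@tends_ext _ (fun N => _)); first by move=> N; symmetry; exact: E.
  apply: tendsZ; rewrite -[B]addr0.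
  have -> : B = w ^+ m * (w ^- m * B) by rewrite mulrA divff ?mul1r // expf_neq0.
  apply: tendsD; first exact: tendsZ.
  rewrite -[0]subr0; apply: tendsB.
    by apply: tends_shift; apply: wt_tends0 => //; lra.
  apply: (@tends_unshift _ m.+1).
  have h0 : tends (fun N => (-1) ^+ b * w^-1 * wt 2^-1 b w^-1 N) 0.
    rewrite -[0](mulr0 ((-1) ^+ b * w^-1)); apply: tendsZ; apply: wt_tends0 => //; lra.
  apply: tends_ext h0 => N.
  have -> : - (N + m.+1)%:R + cm R m = - (N%:R + 2^-1).
    by rewrite /cm natrD -natr1; field.
  rewrite (exprNn (_ + _)) invfM invr_sign /wt -half_real addnS -addSn exprD invfM exprS invfM exprVn.
  have wm' : w ^+ m != 0 by rewrite expf_neq0.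
  have wN' : w ^+ N != 0 by rewrite expf_neq0.
  move: ((_ + _) ^- b) ((-1) ^+ b) => u v; field.
  by rewrite wm' wN' w0.
have [h|[b1 w1]] := regular_or b0 hw.
  have hV := regularV h.
  exists (ti b w + (-1) ^+ b * w^-1 * ti b w^-1).
    apply: Qalg_add; first by apply: Q_euler; exact: ti_euler.
    apply: Qalg_mul; last by apply: Q_euler; exact: ti_euler.
    by apply: Qalg_mul; [apply: QX; apply: QN; exact: Q1|exact: QV_unity].
  apply: (@tends_ext _ (fun N => _)); first by move=> N; symmetry; exact: E0.
  apply: tendsD; last by apply: tendsZ; exact: ti_tends.
  have := tends_shift 1 (ti_tends h).
  by apply: tends_ext => N; rewrite addn1.
exists 0; first exact: Q0.
have h0 : tends (wt 2^-1 b w) 0 by apply: wt_tends0 => //; lra.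
apply: tends_ext h0 => N; rewrite E0 w1 b1 invr1 expr1 mulr1 mulN1r wsumB //.
by rewrite big_nat1 mulr1.
Qed.

(** Packages coefficientwise what the exchange of limits consumes: rows tame uniformly in M, and a
    limit of degree at most [k] in the sums zeta_m. Degrees add under products. *)
Definition PV k (F : nat -> nat -> {poly C}) := forall e,
  tame (fun M m => (F M m)`_e) /\
  exists2 f, nf G (fun n u => zetan n u.1 u.2) k f &
             forall m, tends (fun M => (F M m)`_e) (f m).

Lemma PV_mono k k' F : (k <= k')%N -> PV k F -> PV k' F.
Proof.
by move=> kk' h e; have [t [f hf ft]] := h e; split=> //; exists f => //; exact: nf_mono hf.
Qed.

Lemma PV_cst k (c : {poly C}) : (forall e, Q c`_e) -> PV k (fun _ _ => c).
Proof.
move=> h e; split; first exact: tame_cst.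
by exists (fun=> c`_e); [exact: nf_cst|move=> m; exact: tends_cst].
Qed.

Lemma PV_Xn k n : PV k (fun _ _ => 'X^n).
Proof. by apply: PV_cst => e; rewrite coefXn; case: eqP => _; [exact: Q1|exact: Q0]. Qed.

Lemma PVD k F F' : PV k F -> PV k F' -> PV k (fun M m => F M m + F' M m).
Proof.
move=> h h' e; have [t [f hf ft]] := h e; have [t' [f' hf' ft']] := h' e; split.
  by apply: tame_ext (tameD t t') => M m; rewrite coefD.
exists (fun m => f m + f' m); first exact: nfD.
by move=> m; apply: tends_ext (tendsD (ft m) (ft' m)) => M; rewrite coefD.
Qed.

Lemma PVM k k' F F' : PV k F -> PV k' F' -> PV (k + k') (fun M m => F M m * F' M m).
Proof.
move=> h h' e; split.
  apply: (@tame_ext _ (fun M m => \sum_(i < e.+1) (F M m)`_i * (F' M m)`_(e - i))).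
    by move=> M m; rewrite coefM.
  apply: tame_sum => i; apply: tameM; first by have [] := h i.
  by have [] := h' (e - i)%N.
have /choice[f hf] : forall i : nat, exists f, nf G (fun n u => zetan n u.1 u.2) k f /\
    forall m, tends (fun M => (F M m)`_i) (f m).
  by move=> i; have [_ [f]] := h i; exists f.
have /choice[f' hf'] : forall i : nat, exists f, nf G (fun n u => zetan n u.1 u.2) k' f /\
    forall m, tends (fun M => (F' M m)`_i) (f m).
  by move=> i; have [_ [f']] := h' i; exists f'.
exists (fun m => \sum_(i < e.+1) f i m * f' (e - i)%N m).
  by apply: nf_sum => i; apply: nfM; [exact: (hf i).1|exact: (hf' _).1].
move=> m; apply: (@tends_ext _ (fun M => \sum_(i < e.+1) (F M m)`_i * (F' M m)`_(e - i))).
  by move=> M; rewrite coefM.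
by apply: tends_sum => i; apply: tendsM; [exact: (hf i).2|exact: (hf' _).2].
Qed.

(** As M grows, zeta_(M-m)(y) tends to a polylogarithm value independent of m, which joins the
    coefficients; only zeta_m(y^-1) still varies with m. *)
Lemma PV_gpoly K y p : regular (p, y) -> PV 1 (gpoly K y p).
Proof.
move=> hy e; have h := regularD e hy; have hV := regularV h.
have [B tz] := tame1_zetan h; have [B' tzV] := tame1_zetan hV.
split.
  apply: (@tame_ext _ (fun M m => kap R K p e *
     (zetan (M - m) (p + e) y + (-1) ^+ (p + e) * zetan m (p + e) y^-1))).
    by move=> M m; rewrite coef_gpoly.
  by apply: tameZ; apply: tameD; [exact: tame_rev tz|apply: tameZ; exact: tame_id tzV].
exists (fun m => kap R K p e * (Li (p + e) y + (-1) ^+ (p + e) * zetan m (p + e) y^-1)).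
  apply: nfZ (Q_kap _ _ _) _; apply: nfD.
    by apply: nf_cst; apply: Q_euler; exact: Li_euler.
  apply: nfZ; first by apply: QX; apply: QN; exact: Q1.
  exact: (@nf_base _ _ (fun n u => zetan n u.1 u.2) 1 (_, _) isT hV).
move=> m; apply: (@tends_ext _ (fun M => kap R K p e *
     (zetan (M - m) (p + e) y + (-1) ^+ (p + e) * zetan m (p + e) y^-1))).
  by move=> M; rewrite coef_gpoly.
apply: tendsZ; apply: tendsD (tends_cst _).
by apply: (@tends_sub _ m (fun n => zetan n (p + e) y)); exact: Li_tends.
Qed.

(* Modulo ['X^(\sum p)] the product loses its only monomial of full order. *)
Lemma PV_prod (I : Type) (s : seq I) (p : I -> nat) (g : I -> nat -> nat -> {poly C}) :
  (forall i, PV 1 (g i)) -> (0 < size s)%N ->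
  exists U V, [/\ PV (size s).-1 U, PV (size s) V & forall M m,
    \prod_(i <- s) (1 + 'X^(p i) * g i M m) = U M m + 'X^(\sum_(i <- s) p i) * V M m].
Proof.
move=> hg; elim: s => // i [|j s] IH _.
  exists (fun _ _ => 1), (g i); split=> [|//|M m].
    exact: (PV_Xn 0 0).
  by rewrite !big_seq1.
have [U [V [hU hV E]]] := IH isT.
exists (fun M m => 1 * U M m + 'X^(p i) * (g i M m * U M m) + 'X^(\sum_(i <- j :: s) p i) * V M m),
  (fun M m => g i M m * V M m); split=> [||M m].
- apply: PVD; first apply: PVD.
  + exact: PV_mono (leqnSn _) (PVM (PV_Xn 0 0) hU).
  + exact: (PVM (PV_Xn 0 _) (PVM (hg i) hU)).
  + exact: (PVM (PV_Xn 0 _) hV).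
- exact: (PVM (hg i) hV).
have -> : (\sum_(k <- [:: i, j & s]) p k = p i + \sum_(k <- j :: s) p k)%N by rewrite big_cons.
rewrite big_cons E exprD; set T := 'X^(\sum_(k <- _) _); set X := 'X^(p i); ring.
Qed.

Lemma PV_tends q y k F e : regular (q, y) -> (k < r)%N -> PV k F ->
  exists2 l, LC l & tends (fun M => \sum_(0 <= m < M.+1) wt 2^-1 q y m * (F M m)`_e) l.
Proof.
move=> hq kr /(_ e)[tF [f hf Ff]]; have [q0 hy qy] := hq.
(* The indicator of m <= M, a reversed step function and so tame, moves the upper limit of summation
   into the summand; the finite sums become full series to which [tannery] applies. *)
pose ind n : C := (0 < n)%N%:R.
have tind : tame1 1 ind.
  split=> [n|L].
    by rewrite /ind; case: (0 < n)%N; rewrite ?nm1 ?nm0.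
  case: L => [|L]; first by rewrite big_geq.
  rewrite big_nat_recl // big1 => [|n _]; last by rewrite /ind subrr nm0 expr0n.
  by rewrite /ind subr0 nm1 expr1n addr0.

pose F' M m := ind (M.+1 - m)%N * (F M m)`_e.
have tF' : tame F'.
  apply: tameM tF; have [B' hB'] := tame_rev tind.
  by exists B' => M; exact: hB'.
have F'f m : tends (F' ^~ m) (f m).
  rewrite -[f m]mul1r; apply: tendsM (Ff m).
  move=> e0 e00; exists m => M mM; rewrite /ind subn_gt0 ltnS mM subrr nm0 //.
have [s [l [hs sl fl]]] := tannery (lexx 2^-1) hy q0 qy tF' F'f.
have [l' hl' fl'] := nf_zetan_tends hq kr hf.
exists l'; first exact: hl'.
rewrite (tends_uniq fl' fl); apply: tends_ext sl => M.
apply: tends_uniq (hs M) _; apply: (@tends_unshift _ M.+1).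
apply: tends_ext (tends_cst _) => N.
have MN : (M.+1 <= N + M.+1)%N by exact: leq_addl.
rewrite /wsum [RHS](@big_cat_nat _ _ _ M.+1 0) //=.
have -> : \sum_(M.+1 <= m < N + M.+1) wt 2^-1 q y m * F' M m = 0.
  rewrite big_nat big1 // => m /andP[mM _].
  by rewrite /F' /ind subn_gt0 ltnNge mM mul0r mulr0.
rewrite addr0; apply: eq_big_nat => m /andP[_ mM].
by rewrite /F' /ind subn_gt0 mM mul1r.
Qed.

End Asymptotics.

(** * The parity theorem *)

Section Parity.
Variables (R : realType) (r : nat) (p : 'I_r -> nat) (q : nat).
Variables (xs : 'I_r -> R[i]) (x : R[i]).
Hypotheses (hr : (0 < r)%N) (hxs : forall j, regular (p j, xs j)).
Hypothesis hx : regular (q, x).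
Local Notation C := R[i].
Local Notation G := ([set x] `|` range xs).
Local Notation Q := (Qalg (G `|` @euler_sum R 0)).
Local Notation LC := (lower_order_combination G r).
Local Notation Y := (\prod_(j < r) xs j).
Local Notation w := (x * Y).
Local Notation P := (\sum_(j < r) p j)%N.
Local Notation K := (1 + (q + P))%N.

Let p0 j : (0 < p j)%N. Proof. by have [] := hxs j. Qed.
Let q0 : (0 < q)%N. Proof. by have [] := hx. Qed.
Let uxs j : is_unity_root (xs j). Proof. by have [] := hxs j. Qed.
Let ux : is_unity_root x. Proof. by have [] := hx. Qed.
Let xs0 j : xs j != 0. Proof. exact: unity_neq0. Qed.
Let x0 : x != 0. Proof. exact: unity_neq0. Qed.
Let uY : is_unity_root Y. Proof. exact: unity_prod. Qed.
Let Y0 : Y != 0. Proof. exact: unity_neq0. Qed.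
Let uw : is_unity_root w. Proof. exact: unityM. Qed.
Let Qx : Q x. Proof. by apply: Qalg_gen; left; left. Qed.
Let Qxs j : Q (xs j). Proof. by apply: Qalg_gen; left; right; exists j. Qed.
Let QY : Q Y. Proof. exact: Q_prod. Qed.
Let Qw : Q w. Proof. exact: Qalg_mul. Qed.
Let Qsign n : Q ((-1) ^+ n). Proof. by apply: QX; apply: QN; exact: Q1. Qed.
Let QYV : Q Y^-1. Proof. exact: QV_unity. Qed.
Let QxV : Q x^-1. Proof. exact: QV_unity. Qed.

Let szr : size (index_enum 'I_r) = r.
Proof. by rewrite -sum1_size big_const_ord iter_addn_0 mul1n. Qed.

Lemma zero_residue_tends : exists s l,
  [/\ forall M, tends (fun N => zero_residue p q xs w N M) (s M), tends s l & LC l].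
Proof.
have /choice[phi hphi] : forall e, exists l, Q l /\
    tends (fun N => (loc_sum K 0 (Phi w N))`_e) l.
  by move=> e; have [l] := Phi0_tends G K e uw; exists l.
exists (fun M => \sum_(i < q.+1) phi i * (\prod_(j < r) Areg K (xs j) (p j) M 0)`_(q - i)).
(* One factor supplies the order-zero sum of the combination and the others enter its coefficient,
   whence the nonempty [s]. *)
have prodA (s : seq 'I_r) e : (0 < size s)%N -> exists l, LC l /\
    tends (fun M => (\prod_(j <- s) Areg K (xs j) (p j) M 0)`_e) l.
  have base j e' : exists l, [/\ Q l, LC l & tends (fun M => (Areg K (xs j) (p j) M 0)`_e') l].
    have h := regularD e' (hxs j).
    exists (kap R K (p j) e' * ti (p j + e') (xs j)); split.
    - by apply: Qalg_mul; [exact: Q_kap|apply: Q_euler; exact: ti_euler].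
    - by apply: LC_euler hr (Q_kap _ _ _ _) _; exact: ti_euler.
    apply: (@tends_ext _ (fun M => kap R K (p j) e' * wsum 2^-1 (p j + e') (xs j) (fun=> 1) M.+1)).
      by move=> M; rewrite coef_Areg0.
    apply: tendsZ; have := tends_shift 1 (ti_tends h).
    by apply: tends_ext => M; rewrite addn1.
  elim: s e => // j [|j' s] IH e _.
    have [l [_ hl jl]] := base j e; exists l; split=> //.
    by apply: tends_ext jl => M; rewrite big_seq1.
  have /choice[f hf] := base j; have /choice[g hg] := fun e => IH e isT.
  exists (\sum_(i < e.+1) f i * g (e - i)%N); split.
    by apply: LC_sum => i; have [? _ _] := hf i; apply: LCZ => //; exact: (hg _).1.
  apply: (@tends_ext _ (fun M => \sum_(i < e.+1) (Areg K (xs j) (p j) M 0)`_i *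
     (\prod_(j <- j' :: s) Areg K (xs j) (p j) M 0)`_(e - i))).
    by move=> M; rewrite (big_cons _ _ j) coefM.
  by apply: tends_sum => i; have [_ _ ?] := hf i; apply: tendsM => //; exact: (hg _).2.
have /choice[g hg] : forall e, exists l, LC l /\
    tends (fun M => (\prod_(j < r) Areg K (xs j) (p j) M 0)`_e) l.
  by move=> e; apply: prodA; rewrite szr.
exists (\sum_(i < q.+1) phi i * g (q - i)%N); split.
- move=> M; apply: (@tends_ext _ (fun N => \sum_(i < q.+1) (loc_sum K 0 (Phi w N))`_i *
     (\prod_(j < r) Areg K (xs j) (p j) M 0)`_(q - i))).
    by move=> N; rewrite /zero_residue coefM.
  by apply: tends_sum => i; apply: tendsM (tends_cst _); exact: (hphi i).2.
- by apply: tends_sum => i; apply: tendsZ; exact: (hg _).2.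
by apply: LC_sum => i; apply: LCZ; [exact: (hphi i).1|exact: (hg _).1].
Qed.

Lemma half_residue_tends : exists s l,
  [/\ forall M, tends (fun N => \sum_(0 <= m < M.+1) half_residue p q xs w N M m) (s M),
      tends s l & LC l].
Proof.
have /choice[B hB] : forall b, exists B, Q B /\ ((0 < b)%N ->
    forall m, tends (fun N => Psi w N m b) (w ^- m * B)).
  case=> [|b]; first by exists 0; split=> //; exact: Q0.
  by have [B QB h] := Psi_tends uw Qw (ltn0Sn b); exists B.
(* Limits of the kernel coefficients without their common w^-m. The 0 at [i = 0] reflects that the
   kernel has no pole at the half-integers. *)
pose psi i : C := if i is e.+1 then kap R K 1 e * (-1) ^+ e.+1 * B e.+1 else 0.
have Qpsi i : Q (psi i).
  case: i => [|e]; first exact: Q0.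
  by do 2?apply: Qalg_mul => //; [exact: Q_kap|exact: (hB _).1].
have [||U [V [hU hV E]]] := @PV_prod _ G 'I_r (index_enum 'I_r) p (fun j => gpoly K (xs j) (p j)).
- by move=> j; exact: PV_gpoly.
- by rewrite szr.
rewrite szr in hU hV.
(* As [psi 0] is 0, only degrees P - i with i >= 1 matter. Below degree P the part [V] of full order
   is invisible, and [U] has order at most r - 1. *)
have coefUV M m n : (n < P)%N ->
    (geo K (- cm R m) ^+ q * \prod_(j < r) (1 + 'X^(p j) * gpoly K (xs j) (p j) M m))`_n =
    \sum_(e < n.+1) (-1) ^+ (q + e) * kap R K q e * (cm R m ^- (q + e) * (U M m)`_(n - e)).
  move=> nP; rewrite E mulrDr mulrCA coefD coefXnM nP addr0 coefM.
  apply: eq_bigr => e _; rewrite coef_geo (exprNn (cm R m)) invfM invr_sign.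
  by rewrite !mulrA; congr (_ * _); rewrite -!mulrA; congr (_ * _); rewrite mulrC.
have /choice[h hh] : forall e, exists h : nat -> C, forall n, LC (h n) /\
    tends (fun M => \sum_(0 <= m < M.+1) wt 2^-1 (q + e) x^-1 m * (U M m)`_n) (h n).
  move=> e; suff /choice[h hh] : forall n, exists l, LC l /\
    tends (fun M => \sum_(0 <= m < M.+1) wt 2^-1 (q + e) x^-1 m * (U M m)`_n) l by exists h.
  have rr : (r.-1 < r)%N by rewrite prednK.
  move=> n; have [l] := PV_tends n (regularD e (regularV hx)) rr hU.
  by exists l.
exists (fun M => \sum_(0 <= m < M.+1) \sum_(i < P.+1) psi i *
  \sum_(e < (P - i).+1) (-1) ^+ (q + e) * kap R K q e * (wt 2^-1 (q + e) x^-1 m * (U M m)`_(P - i - e))).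
exists (\sum_(i < P.+1) psi i * \sum_(e < (P - i).+1) (-1) ^+ (q + e) * kap R K q e * h e (P - i - e)%N).
split.
- move=> M; apply: tends_sum => m.
  pose rest i := (geo K (- cm R m) ^+ q * \prod_(j < r) (1 + 'X^(p j) * gpoly K (xs j) (p j) M m))`_i.
  apply: (@tends_ext _ (fun N => Y ^+ m * \sum_(i < P.+1) (loc_sum K (- cm R m) (Phi w N))`_i * rest (P - i)%N)).
    by move=> N; rewrite /half_residue coefM.
  apply: (@tends_eq _ _ (Y ^+ m * \sum_(i < P.+1) (w ^- m * psi i) * rest (P - i)%N)); last first.
    apply: tendsZ; apply: tends_sum => i; apply: tendsM (tends_cst _).
    case: i => -[|e] iP /=.
      by rewrite mulr0; apply: tends_ext (tends_cst 0) => N; rewrite coef0_Phi_half.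
    apply: (@tends_ext _ (fun N => kap R K 1 e * (-1) ^+ e.+1 * Psi w N m e.+1)).
      by move=> N; rewrite coef_Phi_half.
    by rewrite mulrCA; apply: tendsZ; exact: (hB _).2.
  rewrite mulr_sumr; apply: eq_bigr => i _.
  case: i => -[|e] iP /=; first by rewrite mulr0 !mul0r mulr0.
  rewrite /rest coefUV; last by rewrite ltn_subrL; exact: leq_ltn_trans (leq0n e) iP.
  (* The choice of w takes effect: the remaining weight belongs to R-sums with outer argument
     x^-1. *)
  have YM : Y ^+ m * w ^- m = x ^- m.
    by rewrite exprMn invfM mulrCA divff ?mulr1 ?expf_neq0.
  rewrite [LHS]mulrA [Y ^+ m * _]mulrA YM [_ * (kap _ _ _ _ * _ * _)]mulrC.
  rewrite -[LHS]mulrA; congr (_ * _); rewrite mulr_sumr; apply: eq_bigr => i _.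
  by rewrite /wt -half_real exprVn /cm; ring.
- apply: (@tends_ext _ (fun M => \sum_(i < P.+1) psi i *
    \sum_(e < (P - i).+1) (-1) ^+ (q + e) * kap R K q e *
      \sum_(0 <= m < M.+1) wt 2^-1 (q + e) x^-1 m * (U M m)`_(P - i - e))).
    move=> M; rewrite [RHS]exchange_big /=; apply: eq_bigr => i _.
    rewrite -mulr_sumr exchange_big /=; congr (_ * _); apply: eq_bigr => e _.
    by rewrite mulr_sumr.
  apply: tends_sum => i; apply: tendsZ; apply: tends_sum => e; apply: tendsZ.
  exact: (hh _ _).2.
apply: LC_sum => i; apply: LCZ => //; apply: LC_sum => e; apply: LCZ.
  by apply: Qalg_mul => //; exact: Q_kap.
exact: (hh _ _).1.
Qed.

(** The reflection factor of [tn] at negative indices, as in [tn_diff_neg]. *)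
Let alpha j : C := (-1) ^+ (p j).+1 * xs j.

Let Wpos M i : C := \prod_(j < r) (tn (i.+1 + M.+1) (p j) (xs j) - tn i.+1 (p j) (xs j)).
Let Wneg M i : C := \prod_(j < r) (tn (M - i) (p j) (xs j)
  + alpha j * tn (i - M) (p j) (xs j)^-1 - alpha j * tn i.+1 (p j) (xs j)^-1).

Lemma positive_residues N M :
  \sum_(1 <= n < N.+1) w ^+ n * (n%:R ^- q * \prod_(j < r) Aval (xs j) (p j) M n%:R) =
  Y^-1 * x * wsum 1 q x (Wpos M) N.
Proof.
rewrite big_add1 /= mulr_sumr; apply: eq_bigr => i _.
have -> : Wpos M i = Y ^+ i.+2 * \prod_(j < r) Aval (xs j) (p j) M i.+1%:R.
  rewrite -prodrXl -big_split /=; apply: eq_bigr => j _.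
  by rewrite -tn_diff_pos.
rewrite /wt rmorph1 natr1 exprMn; set A := \prod_(j < r) Aval _ _ _ _.
rewrite (exprS Y i.+1) (exprS x i).
have -> (y u v a b c : C) : y != 0 -> y^-1 * u * (v * a * (y * b * c)) = u * v * b * (a * c).
  by move=> y0; field.
by [].
exact: Y0.
Qed.

Lemma negative_residues N M :
  \sum_(1 <= n < N.+1) w ^- n * ((- n%:R) ^- q * \prod_(j < r) Aval (xs j) (p j) M (- n%:R)) =
  Y^-1 * (-1) ^+ q * x^-1 * wsum 1 q x^-1 (Wneg M) N.
Proof.
rewrite big_add1 /= mulr_sumr; apply: eq_bigr => i _.
have E : Y * \prod_(j < r) Aval (xs j) (p j) M (- i.+1%:R) = Y ^+ i.+1 * Wneg M i.
  rewrite -prodrXl -!big_split /=; apply: eq_bigr => j _.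
  exact: tn_diff_neg.
have -> : \prod_(j < r) Aval (xs j) (p j) M (- i.+1%:R) = Y^-1 * (Y ^+ i.+1 * Wneg M i).
  by rewrite -E mulrA mulVf ?mul1r.
rewrite /wt rmorph1 natr1 exprMn (exprNn i.+1%:R) !invfM invr_sign exprVn exprS invfM.
have Yi : Y ^+ i.+1 != 0 by rewrite expf_neq0.
move: (Wneg M i) (i.+1%:R ^- q) ((-1) ^+ q) (x ^- i) (x^-1) (Y^-1) (Y ^+ i.+1) Yi => a b c d e f g g0.
by field.
Qed.

Let T j := xs j * ti (p j) (xs j).
Let QT j : Q (T j).
Proof. by apply: Qalg_mul => //; apply: Q_euler; exact: ti_euler. Qed.

Lemma tn0 n y : tn 0 n y = 0 :> C.
Proof. by rewrite /tn big_geq. Qed.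

(** In the limit M to infinity each factor becomes [T j] minus a t-sum. The product of the t-sums
    alone yields the S-sum with sign (-1)^r; any other monomial contains a constant [T j] and has
    lower order. *)
Lemma positive_tends : exists s l,
  [/\ forall M, tends (wsum 1 q x (Wpos M)) (s M), tends s ((-1) ^+ r * (x^-1 * Ssum p q xs x) + l)
    & LC l].
Proof.
pose g i := \prod_(j < r) (T j + -1 * tn i.+1 (p j) (xs j)).
have [||||s [l [hs sl gl]]] := @tannery _ 1 q x Wpos g _ ux q0 _ _ _.
- by lra.
- by have [] := hx.
- apply: tame_prod => j; have [B tj] := tame1_tn (hxs j).
  have [B' tj'] := tame1_succ tj; have [B2 tj2] := tame1_succ tj'.
  apply: (@tame_ext _ (fun M i => tn (i + M).+2 (p j) (xs j) + -1 * tn i.+1 (p j) (xs j))).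
    by move=> M i; rewrite mulN1r addSn addnS.
  by apply: tameD; [exact: (tame_shift tj2)|apply: tameZ; exact: tame_id tj'].
- move=> i; apply: tends_prod => j.
  rewrite mulN1r; apply: tendsB (tends_cst _).
  have := tends_shift i.+2 (tn_tends (hxs j)).
  by apply: tends_ext => M; rewrite addnC !addSn !addnS.
have := @nf_prod_top _ G (fun n u => tn n.+1 u.1 u.2) 'I_r (index_enum 'I_r) T (fun=> -1) (fun j => (p j, xs j)) QT.
rewrite szr => H.
have rr : (r.-1 < r)%N by rewrite prednK.
have [|l' hl' ll'] := nf_tn_tends hx Qx rr (H _ hxs hr).
  by move=> _; apply: QN; exact: Q1.
exists s, l'; split=> //; apply: tends_eq sl; apply: tends_uniq gl _.
apply: tends_ext (tendsD (tendsZ ((-1) ^+ r) (Ssum_tends hx hxs)) ll') => N.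
rewrite /wsum mulr_sumr -big_split; apply: eq_bigr => i _ /=.
have -> : \prod_(j < r) (-1 * tn i.+1 (p j) (xs j)) = (-1) ^+ r * \prod_(j < r) tn i.+1 (p j) (xs j).
  by rewrite big_split /= prodr_const card_ord.
by rewrite /g; ring.
Qed.

(** The same expansion with reflected t-sums. The delayed sum at i - M is empty once M >= i, and the
    product of the factors - [alpha j] supplies (-1)^P Y. *)
Lemma negative_tends : exists s l,
  [/\ forall M, tends (wsum 1 q x^-1 (Wneg M)) (s M),
    tends s ((-1) ^+ P * Y * (x * Ssum p q (fun j => (xs j)^-1) x^-1) + l) & LC l].
Proof.
have hxV := regularV hx; have hxsV j := regularV (hxs j).
pose g i := \prod_(j < r) (T j + - alpha j * tn i.+1 (p j) (xs j)^-1).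
have [||||s [l [hs sl gl]]] := @tannery _ 1 q x^-1 Wneg g _ (unityV ux) q0 _ _ _.
- by lra.
- by have [] := hxV.
- apply: tame_prod => j; have [B tj] := tame1_tn (hxs j); have [B' tj'] := tame1_tn (hxsV j).
  have [B2 tj2] := tame1_succ tj'.
  apply: (@tame_ext _ (fun M i => (tn (M - i) (p j) (xs j) + alpha j * tn (i - M) (p j) (xs j)^-1)
     + - alpha j * tn i.+1 (p j) (xs j)^-1)).
    by move=> M i; rewrite mulNr.
  apply: tameD; last by apply: tameZ; exact: tame_id tj2.
  by apply: tameD; [exact: tame_rev tj|apply: tameZ; exact: tame_delay tj'].
- move=> i; apply: tends_prod => j.
  rewrite mulNr; apply: tendsB (tends_cst _); rewrite -[T j]addr0; apply: tendsD.
    by apply: (@tends_sub _ i (fun n => tn n (p j) (xs j))); exact: tn_tends.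
  rewrite -[0](mulr0 (alpha j)); apply: tendsZ => e e0; exists i => M iM.
  by have /eqP -> : (i - M == 0)%N; rewrite ?subn_eq0 // tn0 subrr nm0.
have := @nf_prod_top _ G (fun n u => tn n.+1 u.1 u.2) 'I_r (index_enum 'I_r) T (fun j => - alpha j) (fun j => (p j, (xs j)^-1)) QT.
rewrite szr => H.
have rr : (r.-1 < r)%N by rewrite prednK.
have [|l' hl' ll'] := nf_tn_tends hxV QxV rr (H _ hxsV hr).
  by move=> j; apply: QN; apply: Qalg_mul.
exists s, l'; split=> //; apply: tends_eq sl; apply: tends_uniq gl _.
have := Ssum_tends hxV hxsV; rewrite invrK => hS.
apply: tends_ext (tendsD (tendsZ ((-1) ^+ P * Y) hS) ll') => N.
rewrite /wsum mulr_sumr -big_split; apply: eq_bigr => i _ /=.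
have -> : \prod_(j < r) (- alpha j * tn i.+1 (p j) (xs j)^-1) =
    (-1) ^+ P * Y * \prod_(j < r) tn i.+1 (p j) (xs j)^-1.
  rewrite big_split /=; congr (_ * _); rewrite -prodrXr -big_split /=.
  by apply: eq_bigr => j _; rewrite /alpha exprS; ring.
by rewrite /g; ring.
Qed.

Lemma parity : LC (Y^-1 * Ssum p q xs x
  + (-1) ^+ (P + q + r) * Ssum p q (fun j => (xs j)^-1) x^-1).
Proof.
have [sp [lp [hsp slp Llp]]] := positive_tends.
have [sn [ln [hsn sln Lln]]] := negative_tends.
have [s0 [l0 [hs0 sl0 Ll0]]] := zero_residue_tends.
have [sh [lh [hsh slh Llh]]] := half_residue_tends.
have EM M : Y^-1 * x * sp M + Y^-1 * (-1) ^+ q * x^-1 * sn M + s0 M + sh M = 0.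
  have h := tendsD (tendsD (tendsD (tendsZ (Y^-1 * x) (hsp M))
    (tendsZ (Y^-1 * (-1) ^+ q * x^-1) (hsn M))) (hs0 M)) (hsh M).
  apply: tends_uniq h _; apply: tends_ext (tends_cst 0) => N.
  by rewrite -positive_residues -negative_residues residue_identity.
have h := tendsD (tendsD (tendsD (tendsZ (Y^-1 * x) slp)
    (tendsZ (Y^-1 * (-1) ^+ q * x^-1) sln)) sl0) slh.
have {h} E : Y^-1 * x * ((-1) ^+ r * (x^-1 * Ssum p q xs x) + lp) +
    Y^-1 * (-1) ^+ q * x^-1 * ((-1) ^+ P * Y * (x * Ssum p q (fun j => (xs j)^-1) x^-1) + ln)
    + l0 + lh = 0.
  by apply: tends_uniq h _; apply: tends_ext (tends_cst 0) => M; rewrite EM.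
(* In [E] the two S-sums carry (-1)^r Y^-1 and (-1)^(q+P); multiplying by (-1)^r produces the
   coefficients of the statement. *)
have -> : Y^-1 * Ssum p q xs x + (-1) ^+ (P + q + r) * Ssum p q (fun j => (xs j)^-1) x^-1 =
   - ((-1) ^+ r * (Y^-1 * x * lp + Y^-1 * (-1) ^+ q * x^-1 * ln + l0 + lh)).
  have sr : (-1) ^+ r * (-1) ^+ r = 1 :> C by rewrite -expr2 sqrr_sign.
  apply/eqP; rewrite -subr_eq0 opprK -(mulr0 ((-1) ^+ r)) -E !exprD.
  apply/eqP; move: (Ssum p q xs x) (Ssum p q _ x^-1) sr Y0 x0 => S S'.
  move: ((-1) ^+ r) ((-1) ^+ q) ((-1) ^+ P) Y x => a b c y z aa y0 z0.
  have -> : y^-1 * S = a * a * (y^-1 * S) by rewrite aa mul1r.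
  by field; rewrite y0 z0.
apply: LCN; apply: LCZ => //; apply: LCD => //; apply: LCD => //; apply: LCD.
  by apply: LCZ => //; exact: Qalg_mul.
by apply: LCZ => //; apply: Qalg_mul => //; exact: Qalg_mul.
Qed.

End Parity.

Unset Implicit Arguments.

Theorem theorem1p2 (R : realType) (r : nat) (hr : (1 <= r)%N)
    (p : 'I_r -> nat) (q : nat) (xs : 'I_r -> R[i]) (x : R[i])
    (hp : forall j, (0 < p j)%N) (hq : (0 < q)%N)
    (hxs : forall j, is_unity_root (xs j)) (hx : is_unity_root x)
    (hpxs : forall j, (p j, xs j) <> (1%N, 1))
    (hqx : (q, x) <> (1%N, 1)) :
  lower_order_combination ([set x] `|` range xs) r
    ((\prod_(j < r) xs j)^-1 * Ssum p q xs x
     + (-1) ^+ (\sum_(j < r) p j + q + r)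
       * Ssum p q (fun j => (xs j)^-1) x^-1).
Proof.
exact: (parity hr (fun j => And3 (hp j) (hxs j) (hpxs j)) (And3 hq hx hqx)).
Qed.
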